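(* Let $W$ be an irreducible and ergodic transition matrix on a finite set $\mathcal X$, let $g_1,\dots,g_d:\mathcal X\times\mathcal X\to\mathbb R$ be linearly independent under $W$, and let $\{W_{\vec\theta}\}_{\vec\theta\in\mathbb R^d}$ be the exponential family of transition matrices generated by $W$ with the generator $\{g_1,\dots,g_d\}$, with potential function $\phi$. Let $\{P_{\vec\theta}\}_{\vec\theta}$ be an arbitrary family of initial distributions on $\mathcal X$ that is smoothly parametrized by $\vec\theta$. Suppose that $X^{n+1}=(X_{n+1},\dots,X_1)$ is distributed according to $W_{\vec\theta}^{\times n}\times P_{\vec\theta}$. Then for every $\vec\theta$, $$\lim_{n\to\infty} n\,\mathsf{MSE}_{\vec\theta}\Bigl[\frac{\vec g^{\,n}(X^{n+1})}{n}\Bigr]=\lim_{n\to\infty} n\,\mathsf{Cov}_{\vec\theta}\Bigl[\frac{\vec g^{\,n}(X^{n+1})}{n}\Bigr]=\mathsf H_{\vec\theta}[\phi].$$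
   Context: A transition matrix on a finite set $\mathcal X$ is a nonnegative matrix $W(x|x')$ with $\sum_x W(x|x')=1$ for every $x'$; $\mathcal X^2_W:=\{(x,x'):W(x|x')>0\}$. It acts on column vectors by $v\mapsto\sum_{x'}W(x|x')v(x')$. $W$ is irreducible if for all $x,x'$ there is $n$ with $W^n(x|x')>0$, and ergodic if it is irreducible and aperiodic. Functions $g_1,\dots,g_d$ are linearly independent under $W$ if for no non-zero $(c_1,\dots,c_d)\in\mathbb R^d$ do there exist $f:\mathcal X\to\mathbb R$ and $c\in\mathbb R$ with $\sum_j c_jg_j(x,x')=f(x)-f(x')+c$ for all $(x,x')\in\mathcal X_W^2$. Exponential family: for $\vec\theta=(\theta^1,\dots,\theta^d)\in\mathbb R^d$ let $\overline W_{\vec\theta}(x|x'):=W(x|x')e^{\sum_j\theta^jg_j(x,x')}$, let $\lambda_{\vec\theta}$ be its Perron–Frobenius eigenvalue, $\phi(\vec\theta):=\log\lambda_{\vec\theta}$ (potential function), and $\overline P^3_{\vec\theta}$ the Perron–Frobenius (positive) eigenvector of the transpose $\overline W_{\vec\theta}^T$. Put $W_{\vec\theta}(x|x'):=\lambda_{\vec\theta}^{-1}\overline P^3_{\vec\theta}(x)\overline W_{\vec\theta}(x|x')\overline P^3_{\vec\theta}(x')^{-1}$, a transition matrix. $\mathsf H_{\vec\theta}[\phi]:=[\frac{\partial^2\phi}{\partial\theta^i\partial\theta^j}(\vec\theta)]_{i,j}$, and $\eta_j(\vec\theta):=\frac{\partial\phi}{\partial\theta^j}(\vec\theta)$ is the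 expectation parameter. $W_{\vec\theta}^{\times n}\times P_{\vec\theta}(x_{n+1},\dots,x_1):=W_{\vec\theta}(x_{n+1}|x_n)\cdots W_{\vec\theta}(x_2|x_1)P_{\vec\theta}(x_1)$. $\vec g^{\,n}(X^{n+1}):=(g_j^n(X^{n+1}))_j$ with $g_j^n(X^{n+1}):=\sum_{i=1}^n g_j(X_{i+1},X_i)$. $\mathsf E_{\vec\theta}$ and $\mathsf{Cov}_{\vec\theta}$ denote expectation and covariance matrix under $W_{\vec\theta}^{\times n}\times P_{\vec\theta}$, and $\mathsf{MSE}_{\vec\theta}[\vec g^{\,n}(X^{n+1})/n]$ is the matrix with entries $\mathsf E_{\vec\theta}\bigl[(\frac{g_i^n(X^{n+1})}{n}-\eta_i(\vec\theta))(\frac{g_j^n(X^{n+1})}{n}-\eta_j(\vec\theta))\bigr]$. *)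

(* Defs.v *)
From HB Require Import structures.
From mathcomp Require Import all_boot all_order all_algebra.
From mathcomp.real_closed Require Import complex.
From mathcomp Require Import all_classical all_reals all_analysis.
Import Order.TTheory GRing.Theory Num.Theory.
Import numFieldNormedType.Exports.

Set Implicit Arguments.
Unset Strict Implicit.
Unset Printing Implicit Defensive.

Local Open Scope classical_set_scope.
Local Open Scope ring_scope.

(* Matrices indexed by a finite set X are functions A : X -> X -> R, where
   [A x x'] is the entry A(x|x') in row x and column x'. *)

Section Matrices.
Context {R : realType} {X : finType}.
Implicit Types (A W : X -> X -> R) (u : X -> R).

Definition mx_of A : 'M[R]_#|X| :=
  \matrix_(i, j) A (enum_val i) (enum_val j).

Definition powk A (n : nat) (x x' : X) : R :=
  (mx_of A ^+ n) (enum_rank x) (enum_rank x').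

Definition is_distribution u : Prop :=
  (forall x, 0 <= u x) /\ \sum_x u x = 1.

Definition is_transition W : Prop :=
  forall x', is_distribution (fun x => W x x').

Definition irreducible W : Prop :=
  forall x x', exists n, 0 < powk W n x x'.

(* The gcd of the return times to x is 1 for every x. *)
Definition aperiodic W : Prop :=
  forall (x : X) (k : nat),
    (forall n, (0 < n)%N -> 0 < powk W n x x -> (k %| n)%N) -> k = 1%N.

Definition ergodic W : Prop := irreducible W /\ aperiodic W.

(* The spectral radius, computed over the complex eigenvalues. *)
Definition pf_eigenvalue A : R :=
  sup [set r : R | exists2 z : R[i],
    eigenvalue (map_mx (real_complex R) (mx_of A)) z & `|z| = r%:C%C].

(* A positive eigenvector of the transpose of A.  It is unique only up to a
   positive factor; the choice is immaterial in [exp_family] below. *)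
Definition pf_eigenvector_tr A : X -> R :=
  xget (fun=> 0) [set u : X -> R | (forall x, 0 < u x) /\
    forall x', \sum_x A x x' * u x = pf_eigenvalue A * u x'].

End Matrices.

Section PartialDerivatives.
Context {R : realType} {d : nat}.
Implicit Types (f : 'rV[R]_d -> R) (t : 'rV[R]_d).

Definition basis_vec (j : 'I_d) : 'rV[R]_d := delta_mx 0 j.

Definition partial (j : 'I_d) f : 'rV[R]_d -> R :=
  fun t => 'D_(basis_vec j) (f : 'rV[R]_d -> R^o) t.

Definition has_partial (j : 'I_d) f t : Prop :=
  derivable (f : 'rV[R]_d -> R^o) t (basis_vec j).

Definition hessian f t : 'M[R]_d := \matrix_(i, j) partial i (partial j f) t.

(* C^infinity: all iterated partial derivatives exist and are continuous. *)
Definition smooth f : Prop :=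
  forall s : seq 'I_d,
    continuous (foldr partial f s) /\
    forall j t, has_partial j (foldr partial f s) t.

End PartialDerivatives.

Section ExponentialFamily.
Context {R : realType} {X : finType} {d : nat}.
Implicit Types (W : X -> X -> R) (g : 'I_d -> X -> X -> R) (t : 'rV[R]_d).

Definition lin_indep_under W g : Prop :=
  ~ exists c : 'rV[R]_d, c != 0 /\
      exists (f : X -> R) (b : R), forall x x', 0 < W x x' ->
        \sum_j c 0 j * g j x x' = f x - f x' + b.

Definition tilt W g t : X -> X -> R :=
  fun x x' => W x x' * expR (\sum_j t 0 j * g j x x').

Definition potential W g t : R := ln (pf_eigenvalue (tilt W g t)).

Definition exp_family W g t : X -> X -> R :=
  let l := pf_eigenvalue (tilt W g t) in
  let u := pf_eigenvector_tr (tilt W g t) in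
  fun x x' => l^-1 * u x * tilt W g t x x' * (u x')^-1.

Definition expectation_param W g t (j : 'I_d) : R := partial j (potential W g) t.

End ExponentialFamily.

(* A path w : {ffun 'I_n.+1 -> X} encodes X^{n+1} by w i = X_{i+1}; the i-th of
   its n transitions goes from [path_src w i] to [path_tgt w i]. *)
Section Paths.
Context {R : realType} {X : finType} {n : nat}.
Implicit Types (V : X -> X -> R) (P : X -> R) (w : {ffun 'I_n.+1 -> X}).

Definition path_src w (i : 'I_n) : X := w (widen_ord (leqnSn n) i).
Definition path_tgt w (i : 'I_n) : X := w (lift ord0 i).

Definition path_law V P w : R :=
  (\prod_(i < n) V (path_tgt w i) (path_src w i)) * P (w ord0).

Definition expect V P (F : {ffun 'I_n.+1 -> X} -> R) : R :=
  \sum_w path_law V P w * F w.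

(* Second-moment matrix of the vector F around m. *)
Definition moment2 d V P (F : {ffun 'I_n.+1 -> X} -> 'I_d -> R) (m : 'I_d -> R)
    : 'M[R]_d :=
  \matrix_(i, j) expect V P (fun w => (F w i - m i) * (F w j - m j)).

Definition covariance_mx d V P (F : {ffun 'I_n.+1 -> X} -> 'I_d -> R) : 'M[R]_d :=
  moment2 V P F (fun j => expect V P (fun w => F w j)).

Definition sample_sum d (g : 'I_d -> X -> X -> R) w (j : 'I_d) : R :=
  \sum_(i < n) g j (path_tgt w i) (path_src w i).

Definition sample_mean d (g : 'I_d -> X -> X -> R) w (j : 'I_d) : R :=
  sample_sum g w j / n%:R.

End Paths.

Section Estimation.
Context {R : realType} {X : finType} {d : nat}.
Variables (W : X -> X -> R) (g : 'I_d -> X -> X -> R).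
Variable (P : 'rV[R]_d -> X -> R).

Definition mse_sample_mean (n : nat) (t : 'rV[R]_d) : 'M[R]_d :=
  moment2 (exp_family W g t) (P t) (@sample_mean R X n d g)
    (expectation_param W g t).

Definition cov_sample_mean (n : nat) (t : 'rV[R]_d) : 'M[R]_d :=
  covariance_mx (exp_family W g t) (P t) (@sample_mean R X n d g).

End Estimation.

(* Main.v *)
Require Import Defs.
From mathcomp Require Import all_boot all_order all_algebra.
From mathcomp.real_closed Require Import complex.
From mathcomp Require Import all_classical all_reals all_analysis.
From mathcomp Require Import ring lra.
Import Order.TTheory GRing.Theory Num.Theory.
Import numFieldNormedType.Exports.

Set Implicit Arguments.
Unset Strict Implicit.
Unset Printing Implicit Defensive.

Local Open Scope classical_set_scope.
Local Open Scope ring_scope.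

(* Write lam t for the Perron-Frobenius eigenvalue of the tilted matrix and u t
   for its normalized left eigenvector.  Both depend smoothly on t: u is a
   rational function of lam and of the tilted entries by Cramer's rule, and
   conversely the derivative of lam is (u . dA . r) / (u . r), so the order of
   differentiability of lam and u increases alternately.
   The law of a path has density exp (t.S - n phi(t) + ln u(t, X_{n+1})
   - ln u(t, X_1)) with respect to the law under W.  Differentiating once and
   twice the fact that this density has total mass 1 shows that the score
   M_j = S_j - n eta_j + f_j(X_{n+1}) - f_j(X_1), with f_j = d_j ln u, has mean
   0 and that E[M_i M_j] = n H_ij + O(1).  Replacing M by S - n eta costs
   O(sqrt n), and hence both n MSE and n Cov are H + O(1 / sqrt n). *)

(** * Perron-Frobenius theory *)

Section PerronFrobenius.
Context {R : realType} {X : finType}.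
Implicit Types (A : X -> X -> R) (r u v y : X -> R).

(** Left eigenvectors of [A] are expressed below through [mulfv] of the transpose
    [fun x x' => A x' x]. *)
Definition mulfv A v (x : X) : R := \sum_x' A x x' * v x'.

(** Irreducibility in terms of closed sets instead of powers. It depends only on which entries are
    positive, so it survives tilting, and it applies directly to supports of vectors. *)
Definition strongly_connected A : Prop := forall S : {set X}, S != finset.set0 ->
  (forall x x', x' \in S -> 0 < A x x' -> x \in S) -> S = [set: X]%SET.

(** The complement of a set closed under the transposed transitions is closed under those of [A]. *)
Lemma strongly_connected_tr A : strongly_connected A ->
  strongly_connected (fun x x' => A x' x).
Proof.
move=> cA S /set0Pn[s sS] clS; apply/setP => x; rewrite finset.in_setT.
apply/negPn/negP => xS.
suff SC : (~: S)%SET = [set: X]%SET.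
  by have := finset.in_setT s; rewrite -SC inE sS.
apply: cA; first by apply/set0Pn; exists x; rewrite inE.
move=> a b; rewrite !inE => /negP bS Aab; apply/negP => aS.
by apply: bS; apply: clS aS Aab.
Qed.

(** If [s] lies in a closed set [S], induction on [m] shows that column [s] of A^m vanishes outside
    [S], whereas irreducibility makes each entry of that column positive for some power. *)
Lemma irreducible_strongly_connected A :
  (forall x x', 0 <= A x x') -> irreducible A -> strongly_connected A.
Proof.
move=> A0 irrA S /set0Pn[s sS] clS; apply/setP => x; rewrite finset.in_setT.
have [n] := irrA x s; apply: contraTT => xS; rewrite -leNgt.
have pow0 m (z : X) : 0 <= powk A m z s /\ (z \notin S -> powk A m z s <= 0).
  elim: m z => [|m IH] z.
    rewrite /powk expr0 mxE (inj_eq enum_rank_inj).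
    have [->|_] := eqVneq z s; first by rewrite sS ler01.
    by rewrite lexx.
  rewrite /powk exprS -mulmxE mxE; split.
    apply: sumr_ge0 => i _; rewrite mulr_ge0 ?mxE//.
    by have [+ _] := IH (enum_val i); rewrite /powk enum_valK.
  move=> zS; apply: sumr_le0 => i _; rewrite mxE enum_rankK.
  have [] := IH (enum_val i); rewrite /powk enum_valK => p0 pS.
  have [iS|iS] := boolP (enum_val i \in S); last first.
    by rewrite mulr_ge0_le0// pS.
  have [Az0|Az] := leP (A z (enum_val i)) 0; first by rewrite mulr_le0_ge0.
  by case/negP: zS; apply: clS iS Az.
by have [_] := pow0 n x; apply.
Qed.

Lemma finite_lower_bound (f : X -> R) : (forall x, 0 < f x) ->
  exists2 e, 0 < e & forall x, e <= f x.
Proof.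
(* The default value 1 keeps the minimum positive when [X] is empty. *)
move=> f0; exists (\big[Order.min/1]_x f x).
  by apply/bigmin_gtP; split.
by move=> x; apply: bigmin_le_cond.
Qed.

Lemma mulfvD A u v x : mulfv A (fun z => u z + v z) x = mulfv A u x + mulfv A v x.
Proof. by rewrite /mulfv -big_split; apply: eq_bigr => z _; rewrite mulrDr. Qed.

Lemma mulfvZ A c v x : mulfv A (fun z => c * v z) x = c * mulfv A v x.
Proof. by rewrite /mulfv mulr_sumr; apply: eq_bigr => z _; rewrite mulrCA. Qed.

Lemma mulfv_ge0 A v x : (forall x x', 0 <= A x x') -> (forall x, 0 <= v x) ->
  0 <= mulfv A v x.
Proof. by move=> A0 v0; apply: sumr_ge0 => z _; rewrite mulr_ge0. Qed.

(** The support of [v] is closed: where [v a = 0], every term of the nonnegative sum (A v)(a) = 0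
    vanishes. *)
Lemma nonneg_eigenvector_gt0 A l v :
  (forall x x', 0 <= A x x') -> strongly_connected A -> (forall x, 0 <= v x) ->
  (exists x, v x != 0) -> (forall x, mulfv A v x = l * v x) ->
  forall x, 0 < v x.
Proof.
move=> A0 cA v0 [s vs] Av x.
suff /setP/(_ x) : [set z | v z != 0]%SET = [set: X]%SET.
  by rewrite !inE => /esym vx; rewrite lt_def -vx v0.
apply: cA; first by apply/set0Pn; exists s; rewrite inE.
move=> a b; rewrite !inE => vb Aab; apply/eqP => va0.
have := Av a; rewrite va0 mulr0 /mulfv => /eqP.
rewrite psumr_eq0; last by move=> i _; rewrite mulr_ge0.
move=> /allP/(_ b (mem_index_enum b))/=.
by rewrite mulf_eq0 (gt_eqF Aab) (negbTE vb).
Qed.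

(** Subtract from [y] the largest multiple of [r] that stays below it. The difference is a
    nonnegative eigenvector with a zero, hence vanishes identically. *)
Lemma eigenvector_unique A l r y :
  (forall x x', 0 <= A x x') -> strongly_connected A -> (forall x, 0 < r x) ->
  (forall x, mulfv A r x = l * r x) -> (forall x, mulfv A y x = l * y x) ->
  exists c, forall x, y x = c * r x.
Proof.
move=> A0 cA r0 Ar Ay.
have [x0 _|noX] := pickP (@predT X); last by exists 0 => x; have := noX x.
pose m := [arg min_(i < x0) (y i / r i)]%O.
have my x : y m / r m <= y x / r x.
  by rewrite /m; case: arg_minP => // i _; apply.
pose c := y m / r m; exists c.
pose z x := y x + (- c) * r x.
have z0 x : 0 <= z x by rewrite /z mulNr subr_ge0 -ler_pdivlMr// my.
have zm : z m = 0 by rewrite /z /c mulNr divfK ?subrr// gt_eqF.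
move=> x; apply/eqP; rewrite -subr_eq0 -mulNr -/(z x).
apply/negPn/negP => zx.
suff : 0 < z m by rewrite zm ltxx.
apply: (nonneg_eigenvector_gt0 (l := l) A0 cA z0); first by exists x.
by move=> i; rewrite mulfvD mulfvZ Ar Ay /z mulrDr mulrCA.
Qed.

(* Replacing v by v + A v keeps the inequality l v <= A v, and by connectedness
   enlarges the set on which it is strict. *)
Lemma strict_subinvariant A l v :
  (forall x x', 0 <= A x x') -> strongly_connected A -> (forall x, 0 <= v x) ->
  (forall x, l * v x <= mulfv A v x) -> (exists x, l * v x < mulfv A v x) ->
  exists2 u, (forall x, 0 <= u x) & forall x, l * u x < mulfv A u x.
Proof.
move=> A0 cA.
have [k] := ubnP #|[set x | mulfv A v x == l * v x]%SET|.
elim: k v => // k IH v kv v0 vl [s vs].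
have [/forallP vall|] := boolP [forall x, l * v x < mulfv A v x].
  by exists v.
rewrite negb_forall => /existsP[t]; rewrite -leNgt => vt.
pose w x := mulfv A v x + (- l) * v x.
have w0 x : 0 <= w x by rewrite /w mulNr subr_ge0.
pose v' x := v x + mulfv A v x.
have Ev' x : mulfv A v' x + (- l) * v' x = w x + mulfv A w x.
  by rewrite /v' /w !mulfvD mulfvZ; ring.
have Aw0 x : 0 <= mulfv A w x by apply: mulfv_ge0.
have v'l x : l * v' x <= mulfv A v' x.
  by rewrite -subr_ge0 -mulNr Ev' addr_ge0.
apply: (IH v').
- rewrite ltnS in kv; apply: leq_trans kv; apply: proper_card.
  have E x : (mulfv A v' x == l * v' x) = (w x == 0) && (mulfv A w x == 0).
    by rewrite -subr_eq0 -mulNr Ev' paddr_eq0.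
  have Ew x : (mulfv A v x == l * v x) = (w x == 0) by rewrite -subr_eq0 -mulNr.
  rewrite properE; apply/andP; split.
    by apply/fintype.subsetP => x; rewrite !inE E Ew => /andP[].
  (* If equality persisted at all the old points, the support of the excess [w] would be closed,
     hence everything, against the equality at [t]. *)
  apply/negP => /fintype.subsetP sub.
  suff /setP/(_ t) : [set x | w x != 0]%SET = [set: X]%SET.
    by rewrite !inE -Ew eq_le vt vl.
  apply: cA; first by apply/set0Pn; exists s; rewrite inE -Ew gt_eqF.
  move=> a b; rewrite !inE => wb Aab; apply/negP => wa.
  have := sub a; rewrite !inE E Ew wa => /(_ isT)/=.
  rewrite /mulfv psumr_eq0; last by move=> i _; rewrite mulr_ge0.
  move=> /allP/(_ b (mem_index_enum b))/=.
  by rewrite mulf_eq0 (gt_eqF Aab) (negbTE wb).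
- by move=> x; rewrite addr_ge0// mulfv_ge0.
- by [].
- exists s; rewrite -subr_gt0 -mulNr Ev' ltr_wpDr//.
  by rewrite /w mulNr subr_gt0.
Qed.

Lemma closed_le_continuous (T : topologicalType) (f h : T -> R) :
  continuous f -> continuous h -> closed [set p | f p <= h p].
Proof.
move=> cf ch.
have -> : [set p | f p <= h p] = (fun p => h p - f p) @^-1` [set x | 0 <= x].
  by apply/seteqP; split => p /=; rewrite subr_ge0.
apply: closed_comp; last exact: closed_ge.
by move=> p _; apply: continuousB; [exact: ch|exact: cf].
Qed.

Lemma sum_ord_rank (V : nmodType) (f : 'I_#|X| -> V) :
  \sum_i f i = \sum_x f (enum_rank x).
Proof. by rewrite (reindex _ (onW_bij _ (@enum_rank_bij X))). Qed.

Lemma continuous_sum (T : topologicalType) (I : finType) (f : I -> T -> R) :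
  (forall i, continuous (f i)) -> continuous (fun t => \sum_i f i t).
Proof.
move=> cf; apply: (@continuous_big R I +%R 0 xpredT).
  by move=> p; apply: (@continuousD R R^o _ fst snd);
     [exact: cvg_fst|exact: cvg_snd].
by move=> i _; exact: cf.
Qed.

(** The Collatz-Wielandt set: the largest first component over it is the Perron eigenvalue. Vectors
    are stored as row vectors so that compactness of boxes applies. *)
Definition collatz_set A : set (R * 'rV[R]_#|X|) := [set p : R * 'rV[R]_#|X| |
  (forall i, 0 <= p.2 0 i) /\ \sum_i p.2 0 i = 1 /\ 0 <= p.1 /\
  forall x, p.1 * p.2 0 (enum_rank x) <= mulfv A (fun z => p.2 0 (enum_rank z)) x].

(** A closed subset of a box. Summing the inequality s v <= A v over all points, with v <= 1 and
    total 1, bounds [s] by the sum [B] of all entries of [A]. *)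
Lemma collatz_set_compact A :
  (forall x x', 0 <= A x x') -> compact (collatz_set A).
Proof.
move=> A0.
pose B := \sum_x \sum_x' A x x'.
have cc i : continuous (fun p : R * 'rV[R]_#|X| => p.2 0 i).
  move=> p; apply: (@continuous_comp _ _ _ snd (fun M : 'rV[R]_#|X| => M 0 i)).
    exact: cvg_snd.
  exact: coord_continuous.
have c1 : continuous (fun p : R * 'rV[R]_#|X| => p.1) by move=> p; exact: cvg_fst.
pose K := `[0, B] `*` [set v : 'rV[R]_#|X| | forall i, `[0, 1]%classic (v 0 i)].
apply: (@subclosed_compact _ (collatz_set A) K).
- have -> : collatz_set A =
    (\bigcap_i [set p : R * 'rV[R]_#|X| | (fun=> 0) p <= p.2 0 i]) `&`
    ([set p : R * 'rV[R]_#|X| | (\sum_i p.2 0 i) <= (fun=> 1) p] `&`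
     [set p : R * 'rV[R]_#|X| | (fun=> 1) p <= \sum_i p.2 0 i]) `&`
    ([set p : R * 'rV[R]_#|X| | (fun=> 0) p <= p.1] `&`
    (\bigcap_x [set p : R * 'rV[R]_#|X| | p.1 * p.2 0 (enum_rank x) <=
        mulfv A (fun z => p.2 0 (enum_rank z)) x])).
    apply/seteqP; split => p.
      move=> [h1 [h2 [h3 h4]]]; split; first split=> /=.
      + by move=> i _; apply: h1.
      + by rewrite h2.
      + by split => // x _; apply: h4.
    move=> [[h1 [h2 h2']] [h3 h4]]; split; first by move=> i; apply: h1.
    split; first by apply/eqP; rewrite eq_le; apply/andP.
    by split => // x; apply: h4.
  have csum : continuous (fun p : R * 'rV[R]_#|X| => \sum_i p.2 0 i).
    by apply: continuous_sum.
  apply: closedI; first apply: closedI.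
  + apply: closed_bigI => i _; apply: closed_le_continuous => //.
    by move=> ?; exact: cvg_cst.
  + by apply: closedI; apply: closed_le_continuous => // ?; exact: cvg_cst.
  apply: closedI.
    by apply: closed_le_continuous => // ?; exact: cvg_cst.
  apply: closed_bigI => x _; apply: closed_le_continuous.
    by move=> p; apply: continuousM; [exact: c1|exact: cc].
  apply: continuous_sum => i p; apply: continuousM; last exact: cc.
  exact: cvg_cst.
- apply: compact_setX; first exact: segment_compact.
  by apply: (@rV_compact R _ (fun=> `[0, 1]%classic)) => _; exact: segment_compact.
- move=> [s v] [/= v0 [v1 [s0 sv]]].
  have vle1 i : v 0 i <= 1.
    by rewrite -v1 (bigD1 i)//= lerDl sumr_ge0.
  split => /=; last first.
    by move=> i; rewrite in_itv/= v0 vle1.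
  rewrite in_itv/= s0/= -[s]mulr1 -v1 mulr_sumr.
  rewrite sum_ord_rank.
  apply: ler_sum => x _; apply: le_trans (sv x) _.
  by apply: ler_sum => z _; rewrite ler_piMr.
Qed.

Lemma collatz_set_normalize A s v :
  (forall x x', 0 <= A x x') -> 0 <= s -> (forall x, 0 <= v x) ->
  (exists x, v x != 0) -> (forall x, s * v x <= mulfv A v x) ->
  exists p, collatz_set A p /\ p.1 = s.
Proof.
move=> A0 s0 v0 [x vx] sv.
have S0 : 0 < \sum_z v z.
  by rewrite (bigD1 x)//= ltr_pwDl ?lt_def ?vx ?v0// sumr_ge0.
exists (s, \row_i ((\sum_z v z)^-1 * v (enum_val i))); split => //; split => /=.
  by move=> i; rewrite mxE mulr_ge0// invr_ge0 ltW.
split.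
  rewrite sum_ord_rank.
  rewrite (eq_bigr (fun z => (\sum_z v z)^-1 * v z)) => [|z _].
    by rewrite -mulr_sumr mulVf// gt_eqF.
  by rewrite mxE enum_rankK.
split=> // z; rewrite mxE enum_rankK.
rewrite (_ : (fun _ => _) = fun z => (\sum_z v z)^-1 * v z); last first.
  by apply/funext => y; rewrite mxE enum_rankK.
by rewrite mulfvZ mulrCA ler_pM2l ?invr_gt0.
Qed.

(** Maximize the first component over [collatz_set]. If the maximizer were not an eigenvector,
    [strict_subinvariant] would give strict inequality at every point and so leave room for a larger
    value. *)
Lemma perron_eigenvector A : X ->
  (forall x x', 0 <= A x x') -> strongly_connected A ->
  exists l v, (forall x, 0 < v x) /\ forall x, mulfv A v x = l * v x.
Proof.
move=> x0 A0 cA.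
have K0 : collatz_set A !=set0.
  have [||p [Kp _]] :=
    @collatz_set_normalize A 0 (fun=> 1) A0 (lexx _) (fun=> ler01).
  - by exists x0; rewrite oner_eq0.
  - by move=> x; rewrite mul0r mulfv_ge0.
  - by exists p.
have cfst : {within collatz_set A, continuous (fun p : R * 'rV[R]_#|X| => p.1)}.
  by apply: continuous_subspaceT => p; exact: cvg_fst.
have [[l w]] := compact_EVT_max K0 (collatz_set_compact A0) cfst.
rewrite inE => -[/= w0 [w1 [l0 lw]]] lmax.
pose v x := w 0 (enum_rank x).
have v0 x : 0 <= v x by apply: w0.
have vN0 : exists x, v x != 0.
  apply: contrapT => /forallNP vz.
  have : \sum_i w 0 i = 0.
    apply: big1 => i _; rewrite -(enum_valK i).
    by have /negP := vz (enum_val i); rewrite negbK => /eqP.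
  by rewrite w1 => /eqP; rewrite oner_eq0.
exists l, v.
suff Av x : mulfv A v x = l * v x.
  by split=> //; exact: (nonneg_eigenvector_gt0 A0 cA v0 vN0 Av).
apply/eqP; rewrite eq_le lw andbT leNgt; apply/negP => strict.
have [u u0 lu] := strict_subinvariant A0 cA v0 lw (ex_intro _ x strict).
have uN0 : exists x, u x != 0.
  apply: contrapT => /forallNP uz.
  have uE z : u z = 0 by have /negP := uz z; rewrite negbK => /eqP.
  have := lu x0; rewrite uE mulr0 /mulfv big1 ?ltxx// => z _.
  by rewrite uE mulr0.
have [e e0 eu] : exists2 e, 0 < e & forall z, e <= mulfv A u z - l * u z.
  by apply: finite_lower_bound => z; rewrite subr_gt0.
have S0 : 0 < 1 + \sum_z u z by rewrite ltr_pwDl// sumr_ge0.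
(* Raising [l] by this amount costs at most [e] at each point, because u(z) <= 1 + sum u. *)
have d0 : 0 < e / (1 + \sum_z u z) by rewrite divr_gt0.
have [|z|p [Kp pl]] :=
  @collatz_set_normalize A (l + e / (1 + \sum_z u z)) u A0 _ u0 uN0.
- by rewrite addr_ge0// ltW.
- rewrite mulrDl -lerBrDl; apply: le_trans (eu z).
  rewrite mulrAC ler_pdivrMr// ler_pM2l// (bigD1 z)//=.
  by rewrite addrCA lerDl addr_ge0// sumr_ge0.
- have : p \in collatz_set A by rewrite inE.
  by move=> /lmax; rewrite pl /= gerDl leNgt d0.
Qed.

Lemma mulfv_tr A u v : \sum_x' mulfv (fun x x' => A x' x) u x' * v x' =
  \sum_x u x * mulfv A v x.
Proof.
under eq_bigr do rewrite /mulfv mulr_suml.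
rewrite exchange_big; apply: eq_bigr => x _ /=; rewrite mulr_sumr.
by apply: eq_bigr => y _; rewrite mulrAC mulrC.
Qed.

(** The product u A r is both l (u . r) and l' (u . r), with u . r positive. *)
Lemma left_right_eigenvalue A l l' u r : X ->
  (forall x, 0 < u x) -> (forall x, 0 < r x) ->
  (forall x', mulfv (fun x x' => A x' x) u x' = l * u x') ->
  (forall x, mulfv A r x = l' * r x) -> l = l'.
Proof.
move=> x0 u0 r0 uA Ar.
have S0 : \sum_x u x * r x != 0.
  by rewrite gt_eqF// (bigD1 x0)//= ltr_pwDl ?mulr_gt0// sumr_ge0// => ? _;
     rewrite ltW ?mulr_gt0.
apply: (mulIf S0); rewrite !mulr_sumr.
under eq_bigr do rewrite mulrA -uA.
by rewrite mulfv_tr; apply: eq_bigr => x _; rewrite Ar mulrCA.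
Qed.

(** This links the spectral radius to positive eigenvectors. A complex left eigenvector [v] for [z]
    satisfies |z| |v| <= |v| A entrywise; pairing with [r] gives |z| <= l, and [u] shows that [l] is
    itself an eigenvalue. *)
Lemma pf_eigenvalueE A l u r : X -> (forall x x', 0 <= A x x') ->
  (forall x, 0 < u x) -> (forall x, 0 < r x) ->
  (forall x', mulfv (fun x x' => A x' x) u x' = l * u x') ->
  (forall x, mulfv A r x = l * r x) -> pf_eigenvalue A = l.
Proof.
move=> x0 A0 u0 r0 uA Ar.
have l0 : 0 <= l.
  by rewrite -(pmulr_lge0 _ (u0 x0)) -uA mulfv_ge0// => x; exact: ltW.
rewrite /pf_eigenvalue; set E := (X in sup X).
have El : E l.
  exists l%:C%C; last by rewrite ger0_norm// lecR.
  apply/eigenvalueP; exists (map_mx (real_complex R) (\row_i u (enum_val i))).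
    rewrite -map_mxM -map_mxZ; congr map_mx.
    apply/rowP => j; rewrite !mxE -uA sum_ord_rank.
    by apply: eq_bigr => x _; rewrite !mxE enum_rankK mulrC.
  apply/eqP => /rowP/(_ (enum_rank x0)); rewrite !mxE enum_rankK.
  by move=> /eqP; rewrite fmorph_eq0 gt_eqF.
have ubE : ubound E l.
  move=> s [z /eigenvalueP[v vA vN0]] zs.
  rewrite -lecR -zs.
  have [i vi] : exists i, v 0 i != 0.
    apply: contrapT => /forallNP vz; case/negP: vN0; apply/eqP/rowP => i.
    by rewrite mxE; have /negP := vz i; rewrite negbK => /eqP.
  pose S := \sum_x `|v 0 (enum_rank x)| * (r x)%:C%C.
  have S0 : 0 < S.
    rewrite /S (bigD1 (enum_val i))//= enum_valK ltr_pwDl//.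
      by rewrite mulr_gt0 ?normr_gt0// ltcR.
    by rewrite sumr_ge0// => x _; rewrite mulr_ge0 ?normr_ge0// lecR ltW.
  rewrite -(ler_pM2r S0) /S !mulr_sumr.
  have -> : \sum_x l%:C%C * (`|v 0 (enum_rank x)| * (r x)%:C%C) =
      \sum_x' (\sum_x `|v 0 (enum_rank x)| * (A x x')%:C%C) * (r x')%:C%C.
    under [RHS]eq_bigr do rewrite mulr_suml.
    rewrite exchange_big; apply: eq_bigr => x _ /=.
    rewrite mulrCA -rmorphM/= -Ar rmorph_sum/= mulr_sumr.
    by apply: eq_bigr => y _; rewrite rmorphM mulrA.
  apply: ler_sum => x _; rewrite mulrA ler_pM2r ?ltcR// -normrM.
  move/rowP/(_ (enum_rank x)): vA; rewrite !mxE => <-.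
  apply: le_trans (ler_norm_sum _ _ _) _; rewrite sum_ord_rank.
  apply: ler_sum => y _; rewrite normrM !mxE !enum_rankK.
  by rewrite [X in _ * X]ger0_norm// lecR.
apply/eqP; rewrite eq_le; apply/andP; split.
  by apply: ge_sup => //; exists l.
by apply: ub_le_sup => //; exists l.
Qed.

(** Normalizing to total 1 makes both eigenvectors determined by the matrix, as their regularity in
    a parameter requires. *)
Lemma perron_frobenius A : X -> (forall x x', 0 <= A x x') ->
  strongly_connected A ->
  exists u r, [/\ (forall x, 0 < u x), (forall x, 0 < r x),
    \sum_x u x = 1, \sum_x r x = 1 &
    (forall x', mulfv (fun x x' => A x' x) u x' = pf_eigenvalue A * u x') /\
    (forall x, mulfv A r x = pf_eigenvalue A * r x)].
Proof.
move=> x0 A0 cA.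
have [l [r [r0 Ar]]] := perron_eigenvector x0 A0 cA.
have [m [u [u0 uA]]] :=
  perron_eigenvector x0 (fun x x' => A0 x' x) (strongly_connected_tr cA).
have ml := left_right_eigenvalue x0 u0 r0 uA Ar; rewrite {m}ml in uA.
have -> := pf_eigenvalueE x0 A0 u0 r0 uA Ar.
have sum_gt0 (v : X -> R) : (forall x, 0 < v x) -> 0 < \sum_x v x.
  by move=> v0; rewrite (bigD1 x0)//= ltr_pwDl// sumr_ge0// => ? _; exact: ltW.
exists (fun x => (\sum_z u z)^-1 * u x), (fun x => (\sum_z r z)^-1 * r x).
split.
- by move=> x; rewrite mulr_gt0// invr_gt0 sum_gt0.
- by move=> x; rewrite mulr_gt0// invr_gt0 sum_gt0.
- by rewrite -mulr_sumr mulVf// gt_eqF// sum_gt0.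
- by rewrite -mulr_sumr mulVf// gt_eqF// sum_gt0.
- by split => x; rewrite mulfvZ ?uA ?Ar mulrCA.
Qed.

End PerronFrobenius.

(** * Regularity of the Perron eigenvalue and eigenvector *)

Section IteratedPartials.
Context {R : realType} {d : nat}.
Implicit Types (f h : 'rV[R]_d -> R) (t v : 'rV[R]_d).

(** Restricting [f] to the line s v + t reduces the claim to the chain rule in one variable. *)
Lemma is_derive_comp f (F : R -> R) t v (df dF : R) :
  is_derive t v (f : 'rV[R]_d -> R^o) df ->
  is_derive (f t : R^o) 1 (F : R^o -> R^o) dF ->
  is_derive t v (F \o f : 'rV[R]_d -> R^o) (dF * df).
Proof.
have line (k : 'rV[R]_d -> R^o) :
    'D_v k t = 'D_1 (fun s : R => k (s *: v + t)) 0.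
  rewrite /derive; set g1 := fun s => s^-1 *: _; set g2 := fun s => s^-1 *: _.
  suff -> : g1 = g2 by [].
  by rewrite funeqE /g1 /g2 => s /=; rewrite addr0 scale0r add0r [_%:A]mulr1.
move=> [/(derivable1P (f : _ -> R^o)) fd fE] F'.
have f' : is_derive (0 : R^o) 1 (fun s : R => f (s *: v + t) : R^o) df.
  by split; rewrite -?line.
have [/derivable1P cd cE] : is_derive t v (F \o f : 'rV[R]_d -> R^o) (dF * df).
  have := @is_derive1_comp R F (fun s : R => f (s *: v + t)) 0 dF df.
  rewrite scale0r add0r => /(_ F' f')[h1 h2].
  by apply: DeriveDef; [apply/derivable1P|rewrite line].
by apply: DeriveDef; first exact/derivable1P.
Qed.

(** Differentiability is graded by its order, so that the regularity of eigenvalue and eigenvectors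
    can be raised one order at a time. *)
Fixpoint Cn n f : Prop := continuous f /\
  if n is m.+1 then forall j, (forall t, has_partial j f t) /\ Cn m (partial j f)
  else True.

Lemma Cn_continuous n f : Cn n f -> continuous f.
Proof. by case: n => [|n] []. Qed.

(** Closure lemmas such as [CnM] and [CnV] supply an explicit formula for the partial derivatives
    and recurse on it. *)
Lemma CnS_intro n f (df : 'I_d -> 'rV[R]_d -> R) : continuous f ->
  (forall j t, is_derive t (basis_vec j) (f : 'rV[R]_d -> R^o) (df j t)) ->
  (forall j, Cn n (df j)) -> Cn n.+1 f.
Proof.
move=> cf fdf Cdf; split=> // j; split=> [t|]; first by have [] := fdf j t.
have -> // : partial j f = df j.
by apply/funext => t; have [] := fdf j t.
Qed.

Lemma CnS_is_derive n f j t : Cn n.+1 f ->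
  is_derive t (basis_vec j) (f : 'rV[R]_d -> R^o) (partial j f t).
Proof. by move=> [_ /(_ j)[/(_ t) h _]]; apply: DeriveDef. Qed.

Lemma CnS_partial n f j : Cn n.+1 f -> Cn n (partial j f).
Proof. by move=> [_ /(_ j)[]]. Qed.

Lemma CnW n f : Cn n.+1 f -> Cn n f.
Proof.
elim: n f => [|n IH] f [cf pf]; first by split.
by split=> // j; have [dj Cj] := pf j; split=> //; exact: IH.
Qed.

Lemma Cn_cst n (c : R) : Cn n (fun=> c).
Proof.
elim: n c => [|n IH] c; first by split=> // t; exact: cst_continuous.
refine (@CnS_intro n _ (fun _ _ => 0) _ _ _); [move=> t|move=> j].
- exact: cst_continuous.
- exact: IH.
Qed.

Lemma CnD n f h : Cn n f -> Cn n h -> Cn n (fun t => f t + h t).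
Proof.
elim: n f h => [|n IH] f h Cf Ch.
  by split=> // t; apply: continuousD; 
    [exact: Cn_continuous Cf _|exact: Cn_continuous Ch _].
refine (@CnS_intro n _ (fun j t => partial j f t + partial j h t) _ _ _);
  [move=> t|move=> j t|move=> j].
- by apply: continuousD; [exact: Cn_continuous Cf _|exact: Cn_continuous Ch _].
- by apply: is_deriveD; apply: CnS_is_derive; eassumption.
- by apply: IH; apply: CnS_partial.
Qed.

Lemma CnM n f h : Cn n f -> Cn n h -> Cn n (fun t => f t * h t).
Proof.
elim: n f h => [|n IH] f h Cf Ch.
  by split=> // t; apply: continuousM; 
    [exact: Cn_continuous Cf _|exact: Cn_continuous Ch _].
refine (@CnS_intro n _ (fun j t => f t * partial j h t + h t * partial j f t) _ _ _);
  [move=> t|move=> j t|move=> j].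
- by apply: continuousM; [exact: Cn_continuous Cf _|exact: Cn_continuous Ch _].
- by apply: is_deriveM; apply: CnS_is_derive; eassumption.
- by apply: CnD; apply: IH;
     [exact: CnW|exact: CnS_partial|exact: CnW|exact: CnS_partial].
Qed.

Lemma CnN n f : Cn n f -> Cn n (fun t => - f t).
Proof.
move=> Cf; have -> : (fun t => - f t) = (fun t => -1 * f t).
  by apply/funext => t; rewrite mulN1r.
by apply: CnM => //; exact: Cn_cst.
Qed.

Lemma Cn_sum n (I : Type) (s : seq I) (F : I -> 'rV[R]_d -> R) :
  (forall i, Cn n (F i)) -> Cn n (fun t => \sum_(i <- s) F i t).
Proof.
move=> CF; elim: s => [|i s IH].
  by under eq_fun do rewrite big_nil; exact: Cn_cst.
by under eq_fun do rewrite big_cons; exact: CnD.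
Qed.

Lemma Cn_prod n (I : Type) (s : seq I) (F : I -> 'rV[R]_d -> R) :
  (forall i, Cn n (F i)) -> Cn n (fun t => \prod_(i <- s) F i t).
Proof.
move=> CF; elim: s => [|i s IH].
  by under eq_fun do rewrite big_nil; exact: Cn_cst.
by under eq_fun do rewrite big_cons; exact: CnM.
Qed.

Lemma is_derive_coord (i j : 'I_d) t :
  is_derive t (basis_vec j) (fun t => t 0 i : R^o) ((i == j)%:R : R).
Proof.
have q : (fun s : R => s^-1 *: ((s *: basis_vec j + t) 0 i - t 0 i : R^o)) @ 0^'
    --> ((i == j)%:R : R^o).
  (* The difference quotient of a coordinate is constant away from 0. *)
  apply: cvg_near_cst; near=> s; apply/eqP.
  rewrite !mxE addrK -[_ *: _]/(_ * _) mulrA mulVf ?mul1r ?eqxx//.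
  by near: s; exact: nbhs_dnbhs_neq.
by apply: DeriveDef; [apply/cvg_ex; exists (i == j)%:R|exact: cvg_lim].
Unshelve. all: by end_near. Qed.

Lemma Cn_coord n (i : 'I_d) : Cn n (fun t => t 0 i).
Proof.
case: n => [|n]; first by split=> // t; exact: coord_continuous.
refine (@CnS_intro n _ (fun j _ => (i == j)%:R) _ _ _);
  [move=> t|move=> j t|move=> j].
- exact: coord_continuous.
- exact: is_derive_coord.
- exact: Cn_cst.
Qed.

Lemma Cn_expR n f : Cn n f -> Cn n (fun t => expR (f t)).
Proof.
elim: n f => [|n IH] f Cf.
  split=> // t; apply: continuous_comp; first exact: Cn_continuous Cf _.
  exact: continuous_expR.
refine (@CnS_intro n _ (fun j t => expR (f t) * partial j f t) _ _ _);
  [move=> t|move=> j t|move=> j].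
- apply: continuous_comp; first exact: Cn_continuous Cf _.
  exact: continuous_expR.
- by apply: is_derive_comp; apply: CnS_is_derive; eassumption.
- by apply: CnM; [apply: IH; exact: CnW|exact: CnS_partial].
Qed.

Lemma CnV n f : (forall t, f t != 0) -> Cn n f -> Cn n (fun t => (f t)^-1).
Proof.
move=> f0; elim: n => [|n IH] Cf.
  by split=> // t; apply: continuousV => //; exact: Cn_continuous Cf _.
refine (@CnS_intro n _ (fun j t => - ((f t)^-1 * (f t)^-1 * partial j f t)) _ _ _);
  [move=> t|move=> j t|move=> j].
- by apply: continuousV => //; exact: Cn_continuous Cf _.
- have [h1 h2] := CnS_is_derive j t Cf.
  apply: DeriveDef; first exact: derivableV.
  by rewrite deriveV// expr2 invfM h2 scaleNr.
- apply: CnN; apply: CnM; last exact: CnS_partial.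
  by apply: CnM; apply: IH; exact: CnW.
Qed.

Lemma Cn_ln n f : (forall t, 0 < f t) -> Cn n f -> Cn n (fun t => ln (f t)).
Proof.
move=> f0 Cf.
have cln : continuous (fun t => ln (f t)).
  move=> t; apply: continuous_comp; first exact: Cn_continuous Cf _.
  exact: continuous_ln.
case: n Cf => [|n] Cf; first by split.
refine (@CnS_intro n _ (fun j t => (f t)^-1 * partial j f t) _ _ _);
  [exact: cln|move=> j t|move=> j].
- by apply: is_derive_comp; [exact: CnS_is_derive Cf|exact: is_derive1_ln].
- apply: CnM; last exact: CnS_partial.
  by apply: CnV; [move=> t; rewrite gt_eqF|exact: CnW].
Qed.

Lemma Cn_det n m (M : 'rV[R]_d -> 'M[R]_m) :
  (forall i j, Cn n (fun t => M t i j)) -> Cn n (fun t => \det (M t)).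
Proof.
move=> CM; rewrite /determinant; apply: Cn_sum => s.
by apply: CnM; [exact: Cn_cst|apply: Cn_prod].
Qed.

(** Cramer's rule: the entries of b M^-1 are polynomials in the entries of [M] divided by the
    nonvanishing determinant. *)
Lemma Cn_solve n m (M : 'rV[R]_d -> 'M[R]_m) (u : 'rV[R]_d -> 'rV[R]_m)
    (b : 'rV[R]_m) :
  (forall t, M t \in unitmx) -> (forall i j, Cn n (fun t => M t i j)) ->
  (forall t, u t *m M t = b) -> forall i, Cn n (fun t => u t 0 i).
Proof.
move=> Mu CM uM i.
have -> : (fun t => u t 0 i) =
    fun t => \sum_j b 0 j * ((\det (M t))^-1 *
      ((-1) ^+ (i + j) * \det (row' i (col' j (M t))))).
  apply/funext => t; rewrite -[u t in LHS](mulmxK (Mu t)) uM mxE.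
  by apply: eq_bigr => j _; rewrite /invmx Mu !mxE.
apply: Cn_sum => j; apply: CnM; first exact: Cn_cst.
apply: CnM.
  by apply: CnV; [move=> t; rewrite -unitfE -unitmxE|exact: Cn_det].
apply: CnM; first exact: Cn_cst.
apply: Cn_det => k l.
by under eq_fun do rewrite !mxE; exact: CM.
Qed.

End IteratedPartials.

(** * Eigenvectors and eigenvalue of a matrix depending on a parameter *)

Section EigenRegularity.
Context {R : realType} {X : finType} {d : nat}.
Variable (x0 : X).
Variables (A : 'rV[R]_d -> X -> X -> R) (l : 'rV[R]_d -> R).
Variables (u r : 'rV[R]_d -> X -> R).
Hypothesis A0 : forall t x x', 0 <= A t x x'.
Hypothesis A_connected : forall t, strongly_connected (A t).
Hypothesis u0 : forall t x, 0 < u t x.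
Hypothesis r0 : forall t x, 0 < r t x.
Hypothesis uA : forall t x', mulfv (fun x x' => A t x' x) (u t) x' = l t * u t x'.
Hypothesis Ar : forall t x, mulfv (A t) (r t) x = l t * r t x.

(* The normalized eigenvector is the unique solution of u (A - l - J) = - 1,
   with J the all-ones matrix, so Cramer's rule applies. *)
Lemma Cn_eigenvector n : (forall t, \sum_x u t x = 1) ->
  (forall x x', Cn n (fun t => A t x x')) -> Cn n l ->
  forall x, Cn n (fun t => u t x).
Proof.
move=> u1 CA Cl x.
pose M t : 'M[R]_#|X| := mx_of (A t) - (l t)%:M - const_mx 1.
have vM t (v : 'rV[R]_#|X|) j : (v *m M t) 0 j =
    mulfv (fun x x' => A t x' x) (fun x => v 0 (enum_rank x)) (enum_val j)
    - l t * v 0 j - \sum_x v 0 (enum_rank x).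
  rewrite /M !mulmxBr mul_mx_scalar !mxE; congr (_ - _ - _).
    rewrite sum_ord_rank; apply: eq_bigr => y _.
    by rewrite !mxE enum_rankK mulrC.
  by rewrite sum_ord_rank; apply: eq_bigr => y _; rewrite !mxE mulr1.
have Mu t : M t \in unitmx.
  rewrite -row_free_unit; apply/inj_row_free => v vMz.
  pose y z := v 0 (enum_rank z); pose S := \sum_z y z.
  have yE z : mulfv (fun x x' => A t x' x) y z = l t * y z + S.
    have := vM t v (enum_rank z).
    rewrite vMz mxE enum_rankK -/y -/S -/(y z) => /esym/eqP.
    by rewrite subr_eq0 subr_eq addrC => /eqP.
  (* Pairing y A = l y + S with the right eigenvector [r] leaves S times the positive total of [r]
     equal to 0. *)
  have S0 : S = 0.
    have rS0 : \sum_x r t x != 0.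
      by rewrite gt_eqF// (bigD1 x0)//= ltr_pwDl// sumr_ge0// => ? _; exact: ltW.
    apply: (mulIf rS0); rewrite mul0r mulr_sumr.
    have := mulfv_tr (A t) y (r t).
    under eq_bigr do rewrite yE mulrDl.
    rewrite big_split/= => /eqP; rewrite addrC eq_sym -subr_eq => /eqP <-.
    apply/eqP; rewrite subr_eq0; apply/eqP; apply: eq_bigr => z _.
    by rewrite Ar mulrCA mulrA.
  (* The kernel vector is now a left eigenvector, a multiple of [u t]; its total [S] equals [c], so
     it vanishes. *)
  have [c cE] : exists c, forall z, y z = c * u t z.
    apply: (eigenvector_unique _
      (strongly_connected_tr (@A_connected t)) (u0 t) (uA t)) => //.
    by move=> z; rewrite yE S0 addr0.
  have c0 : c = 0.
    by rewrite -S0 /S (eq_bigr (fun z => c * u t z))// -mulr_sumr u1 mulr1.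
  apply/rowP => i; rewrite mxE -(enum_valK i) -/(y _) cE c0 mul0r//.
have := @Cn_solve R d n _ M (fun t => \row_i u t (enum_val i)) (const_mx (-1)) Mu.
have CM i j : Cn n (fun t => M t i j).
  rewrite (_ : (fun _ => _) = fun t => A t (enum_val i) (enum_val j)
       - l t *+ (i == j) - 1); last by apply/funext => t; rewrite !mxE.
  apply: CnD; last exact: Cn_cst.
  apply: CnD => //; apply: CnN.
  by case: (i == j); [exact: Cl|exact: Cn_cst].
move=> /(_ CM).
have uM t : (\row_i u t (enum_val i)) *m M t = const_mx (-1).
  apply/rowP => j; rewrite vM !mxE.
  rewrite (_ : (fun _ => _) = u t); last by apply/funext => z;
     rewrite mxE enum_rankK.
  rewrite uA subrr sub0r; congr (- _); rewrite -(u1 t).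
  by apply: eq_bigr => z _; rewrite mxE enum_rankK.
move=> /(_ uM (enum_rank x)).
rewrite (_ : (fun _ => _) = fun t => u t x)//.
by apply/funext => t; rewrite mxE enum_rankK.
Qed.

(** First-order perturbation formula. Continuity of [u] is enough to pass to the limit, which is
    what lets the induction on the order gain one derivative. *)
Lemma is_derive_eigenvalue (dA : 'I_d -> 'rV[R]_d -> X -> X -> R) j t :
  (forall x, continuous (fun t => u t x)) ->
  (forall x x', is_derive t (basis_vec j) (fun t => A t x x' : R^o) (dA j t x x')) ->
  is_derive t (basis_vec j) (l : _ -> R^o)
    ((\sum_x \sum_x' u t x * (dA j t x x' * r t x')) / \sum_x u t x * r t x).
Proof.
move=> cu AdA.
set v := basis_vec j.
have S0 s : \sum_x u s x * r t x != 0.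
  by rewrite gt_eqF// (bigD1 x0)//= ltr_pwDl ?mulr_gt0// sumr_ge0// => ? _;
     rewrite ltW ?mulr_gt0.
(* An exact identity, obtained by pairing the left eigenvector at [s] with the right eigenvector at
   [t]; no eigenvector is differenced. *)
have key s : (l s - l t) * (\sum_x u s x * r t x) =
    \sum_x \sum_x' u s x * ((A s x x' - A t x x') * r t x').
  rewrite mulrBl !mulr_sumr.
  under eq_bigr do rewrite mulrA -uA.
  under [X in _ - X]eq_bigr do rewrite mulrCA -Ar.
  rewrite mulfv_tr -sumrB; apply: eq_bigr => x _.
  rewrite -mulrBr /mulfv -sumrB mulr_sumr; apply: eq_bigr => y _.
  by rewrite mulrBl.
have vt : (fun s : R => s *: v + t) @ 0^' --> t.
  have : (fun s : R => s *: v + t) @ 0 --> 0 *: v + t.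
    by apply: cvgD; [apply: cvgZl; exact: cvg_id|exact: cvg_cst].
  by rewrite scale0r add0r => h; apply: cvg_trans h;
     apply: cvg_app; exact: cvg_within.
have cuv x : (fun s : R => u (s *: v + t) x) @ 0^' --> u t x.
  exact: (cvg_comp _ _ vt (cu x t)).
have q : (fun s : R => s^-1 *: (l (s *: v + t) - l t : R^o)) @ 0^' -->
    ((\sum_x \sum_x' u t x * (dA j t x x' * r t x')) / \sum_x u t x * r t x : R^o).
  rewrite (_ : (fun _ => _) = fun s : R =>
    (\sum_x \sum_x' u (s *: v + t) x *
      ((s^-1 * (A (s *: v + t) x x' - A t x x')) * r t x')) /
    \sum_x u (s *: v + t) x * r t x); last first.
    apply/funext => s; apply: (mulIf (S0 (s *: v + t))).
    rewrite divfK// -[_ *: _]/(_ * _) -mulrA key !mulr_sumr.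
    apply: eq_bigr => x _; rewrite mulr_sumr; apply: eq_bigr => y _.
    by rewrite mulrCA !mulrA.
  have add_cont : continuous (fun z : R * R => z.1 + z.2).
    by move=> z; apply: cvgD; [exact: cvg_fst|exact: cvg_snd].
  apply: cvgM.
    apply: (cvg_big add_cont) => x _; apply: (cvg_big add_cont) => y _.
    apply: cvgM; first exact: cuv.
    apply: cvgM; last exact: cvg_cst.
    by have [h <-] := AdA x y; exact: h.
  apply: cvgV; first exact: S0.
  apply: (cvg_big add_cont) => x _.
  by apply: cvgM; [exact: cuv|exact: cvg_cst].
by apply: DeriveDef; [apply/cvg_ex; eexists; exact: q|exact: cvg_lim].
Qed.

End EigenRegularity.

(** The bootstrap: order n for [l] gives order n for [u] and [r] by Cramer's rule, hence for the
    derivative of [l] by the perturbation formula. Continuity of [l] starts the induction. *)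
Lemma Cn_eigenvalue (R : realType) (X : finType) d (x0 : X)
    (A : 'rV[R]_d -> X -> X -> R) (l : 'rV[R]_d -> R)
    (u r : 'rV[R]_d -> X -> R) n :
  (forall t x x', 0 <= A t x x') -> (forall t, strongly_connected (A t)) ->
  (forall t x, 0 < u t x) -> (forall t x, 0 < r t x) ->
  (forall t, \sum_x u t x = 1) -> (forall t, \sum_x r t x = 1) ->
  (forall t x', mulfv (fun x x' => A t x' x) (u t) x' = l t * u t x') ->
  (forall t x, mulfv (A t) (r t) x = l t * r t x) ->
  continuous l -> (forall x x', Cn n (fun t => A t x x')) -> Cn n l.
Proof.
move=> A0 cA u0 r0 u1 r1 uA Ar cl.
elim: n => [|n IH] CA; first by split.
have Cl : Cn n l by apply: IH => x x'; exact: CnW.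
have Cu x : Cn n (fun t => u t x).
  by apply: (Cn_eigenvector x0 A0 cA u0 r0 uA Ar u1) => // y y'; exact: CnW.
(* The right eigenvector is the left eigenvector of the transposed matrix. *)
have Cr x : Cn n (fun t => r t x).
  have A0' t y y' : 0 <= A t y' y by [].
  by apply: (Cn_eigenvector x0 A0' (fun t => strongly_connected_tr (@cA t))
    r0 u0 Ar uA r1) => // y y'; exact: CnW.
refine (@CnS_intro R d n _ (fun j t => (\sum_x \sum_x' u t x *
  (partial j (fun t => A t x x') t * r t x')) / \sum_x u t x * r t x) cl _ _).
  move=> j t; apply: (@is_derive_eigenvalue R X d x0 A l u r u0 r0 uA Ar
    (fun j t x x' => partial j (fun t => A t x x') t)).
    by move=> x; exact: Cn_continuous (Cu x).
  by move=> x x'; exact: CnS_is_derive (CA x x').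
move=> j; apply: CnM.
  apply: Cn_sum => x; apply: Cn_sum => y; apply: CnM => //.
  by apply: CnM => //; exact: CnS_partial.
apply: CnV => [t|]; last by apply: Cn_sum => x; exact: CnM.
by rewrite gt_eqF// (bigD1 x0)//= ltr_pwDl ?mulr_gt0// sumr_ge0// => ? _;
   rewrite ltW ?mulr_gt0.
Qed.

(** Pair the left eigenvector of [A] with the right one of [B]: l (u . r) = u A r <= c (u B r) = c m
    (u . r). *)
Lemma eigenvalue_le_scale (R : realType) (X : finType) (x0 : X)
    (A B : X -> X -> R) c l m (u r : X -> R) :
  (forall x x', A x x' <= c * B x x') ->
  (forall x, 0 < u x) -> (forall x, 0 < r x) ->
  (forall x', mulfv (fun x x' => A x' x) u x' = l * u x') ->
  (forall x, mulfv B r x = m * r x) -> l <= c * m.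
Proof.
move=> AB u0 r0 uA Br.
have S0 : 0 < \sum_x u x * r x.
  by rewrite (bigD1 x0)//= ltr_pwDl ?mulr_gt0// sumr_ge0// => ? _;
     rewrite ltW ?mulr_gt0.
rewrite -(ler_pM2r S0) !mulr_sumr.
under eq_bigr do rewrite mulrA -uA.
rewrite mulfv_tr; apply: ler_sum => x _.
rewrite mulrCA ler_pM2l// -mulrA -Br mulr_sumr; apply: ler_sum => y _.
by rewrite mulrA ler_pM2r.
Qed.

(** * The Perron eigenvalue and eigenvector of the tilted matrices *)

Section Tilt.
Context {R : realType} {X : finType} {d : nat}.
Variables (x0 : X) (W : X -> X -> R) (g : 'I_d -> X -> X -> R).
Hypothesis W_transition : is_transition W.
Hypothesis W_irreducible : irreducible W.

Let lam t := pf_eigenvalue (tilt W g t).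

Lemma tilt_ge0 t x x' : 0 <= tilt W g t x x'.
Proof. by rewrite mulr_ge0 ?expR_ge0//; have [] := W_transition x'. Qed.

Lemma tilt_strongly_connected t : strongly_connected (tilt W g t).
Proof.
have cW : strongly_connected W.
  apply: irreducible_strongly_connected => // x x'.
  by have [] := W_transition x'.
move=> S S0 clS; apply: cW => // x x' Sx' Wxx'; apply: clS Sx' _.
by rewrite mulr_gt0 ?expR_gt0.
Qed.

Lemma Cn_tilt n x x' : Cn n (fun t => tilt W g t x x').
Proof.
apply: CnM; first exact: Cn_cst.
apply: Cn_expR; apply: Cn_sum => j; apply: CnM; first exact: Cn_coord.
exact: Cn_cst.
Qed.

(** Column [x0] of [W] has total 1, hence a positive entry, which makes the left eigenvector
    equation at [x0] positive. *)
Lemma pf_eigenvalue_tilt_gt0 t : 0 < lam t.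
Proof.
have [u [r [u0 r0 u1 _ [uA _]]]] :=
  perron_frobenius x0 (@tilt_ge0 t) (@tilt_strongly_connected t).
rewrite -(pmulr_lgt0 _ (u0 x0)) -uA.
have [W0 W1] := W_transition x0.
have term0 x : 0 <= tilt W g t x x0 * u x by rewrite mulr_ge0 ?tilt_ge0 ?ltW.
rewrite lt_def sumr_ge0// andbT psumr_neq0//.
apply: contraT => /hasPn noW; move: W1; rewrite big1 => [/esym/eqP|x _].
  by rewrite oner_eq0.
have := noW x (mem_index_enum x); rewrite /= -leNgt => h.
have : tilt W g t x x0 * u x == 0 by rewrite eq_le h term0.
by rewrite !mulf_eq0 (gt_eqF (u0 x)) (gt_eqF (expR_gt0 _)) !orbF => /eqP.
Qed.

(** Entrywise the tilts at [t] and [s] differ by factors between exp(-D t) and exp(D t), so [lam t]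
    is squeezed between the same multiples of [lam s], and D tends to 0 at [s]. *)
Lemma pf_eigenvalue_tilt_continuous : continuous lam.
Proof.
suff h (s : 'rV[R]_d) : lam @ s --> lam s by move=> s; exact: h.
pose D (t : 'rV[R]_d) := \sum_x \sum_x' `|\sum_j (t 0 j - s 0 j) * g j x x'|.
have tiltE (a b : 'rV[R]_d) x x' : tilt W g a x x' =
    expR (\sum_j (a 0 j - b 0 j) * g j x x') * tilt W g b x x'.
  rewrite /tilt mulrCA -expRD -big_split/=; congr (_ * expR _).
  by apply: eq_bigr => j _; rewrite mulrBl subrK.
have DE (t : 'rV[R]_d) x x' : `|\sum_j (t 0 j - s 0 j) * g j x x'| <= D t.
  rewrite /D (bigD1 x)//= (bigD1 x')//= -addrA lerDl addr_ge0//.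
    by apply: sumr_ge0.
  by apply: sumr_ge0 => ? _; apply: sumr_ge0.
have lamle (a b : 'rV[R]_d) c :
    (forall x x', \sum_j (a 0 j - b 0 j) * g j x x' <= c) ->
    lam a <= expR c * lam b.
  move=> abc.
  have [u [_ [u0 _ _ _ [uA _]]]] :=
    perron_frobenius x0 (@tilt_ge0 a) (@tilt_strongly_connected a).
  have [_ [r [_ r0 _ _ [_ Br]]]] :=
    perron_frobenius x0 (@tilt_ge0 b) (@tilt_strongly_connected b).
  apply: (eigenvalue_le_scale x0 _ u0 r0 uA Br) => x x'.
  by rewrite (tiltE a b) ler_wpM2r ?tilt_ge0// ler_expR.
have cD : continuous D.
  apply: continuous_sum => x; apply: continuous_sum => y t.
  have cS : continuous (fun t : 'rV[R]_d => \sum_j (t 0 j - s 0 j) * g j x y).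
    apply: (@Cn_continuous R d 0); apply: Cn_sum => j; apply: CnM; last exact: Cn_cst.
    by apply: CnD; [exact: Cn_coord|exact: Cn_cst].
  by apply: continuous_comp; [exact: cS|exact: norm_continuous].
have Ds : D s = 0.
  by rewrite /D big1// => x _; rewrite big1// => y _;
     rewrite big1 ?normr0// => j _; rewrite subrr mul0r.
apply: (squeeze_cvgr (Fa := nbhs_filter s)
  (f := fun t => expR (- D t) * lam s) (h := fun t => expR (D t) * lam s)).
- apply/nearW => t; apply/andP; split.
    rewrite -ler_pdivlMl ?expR_gt0// -expRN opprK; apply: lamle => x x'.
    apply: le_trans (DE t x x'); rewrite -[leRHS]normrN.
    apply: le_trans (ler_norm _).
    by rewrite -sumrN; apply: ler_sum => j _; rewrite -mulNr opprB.
  by apply: lamle => x x'; apply: le_trans (ler_norm _) (DE t x x').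
- have C : continuous (fun t => expR (- D t) * lam s).
    apply: (@Cn_continuous R d 0); apply: CnM; last exact: Cn_cst.
    exact/Cn_expR/CnN.
  by have := C s; rewrite /continuous_at Ds oppr0 expR0 mul1r.
- have C : continuous (fun t => expR (D t) * lam s).
    by apply: (@Cn_continuous R d 0); apply: CnM; [exact: Cn_expR|exact: Cn_cst].
  by have := C s; rewrite /continuous_at Ds expR0 mul1r.
Qed.

(** The eigenvector chosen in [exp_family] is an unspecified multiple of the normalized one. The
    factor cancels between u(x) and the inverse of u(x'), so the family can be written with a
    regular [u]. *)
Lemma regular_perron_eigenvector : exists u : 'rV[R]_d -> X -> R,
  [/\ forall t x, 0 < u t x,
      forall t x x', exp_family W g t x x' =
        (lam t)^-1 * u t x * tilt W g t x x' * (u t x')^-1,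
      forall n x, Cn n (fun t => u t x), forall n, Cn n lam &
      forall t, is_transition (exp_family W g t)].
Proof.
have /choice[u /choice[r ur]] : forall t, exists u r : X -> R, _ :=
  fun t => perron_frobenius x0 (@tilt_ge0 t) (@tilt_strongly_connected t).
have u0 t : forall x, 0 < u t x by have [] := ur t.
have r0 t : forall x, 0 < r t x by have [] := ur t.
have u1 t : \sum_x u t x = 1 by have [] := ur t.
have r1 t : \sum_x r t x = 1 by have [] := ur t.
have uA t :
    forall x', mulfv (fun x x' => tilt W g t x' x) (u t) x' = lam t * u t x'.
  by have [_ _ _ _ []] := ur t.
have Ar t : forall x, mulfv (tilt W g t) (r t) x = lam t * r t x.
  by have [_ _ _ _ []] := ur t.
have Clam n : Cn n lam.
  apply: (Cn_eigenvalue x0 tilt_ge0 tilt_strongly_connected u0 r0 u1 r1 uA Ar).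
    exact: pf_eigenvalue_tilt_continuous.
  exact: Cn_tilt.
have famE t x x' : exp_family W g t x x' =
    (lam t)^-1 * u t x * tilt W g t x x' * (u t x')^-1.
  rewrite /exp_family /= -/(lam t).
  have [w0 wA] : (forall x, 0 < pf_eigenvector_tr (tilt W g t) x) /\
      forall x', \sum_x tilt W g t x x' * pf_eigenvector_tr (tilt W g t) x =
        lam t * pf_eigenvector_tr (tilt W g t) x'.
    (* The default value of [xget] never occurs, since [u t] is a witness. *)
    rewrite /pf_eigenvector_tr; case: xgetP => [v _ //|/(_ (u t)) noU].
    by exfalso; apply: noU; split; [exact: u0|exact: uA].
  move: (pf_eigenvector_tr _) w0 wA => w w0 wA.
  have [c cE] := eigenvector_unique (fun x x' => @tilt_ge0 t x' x)
    (strongly_connected_tr (@tilt_strongly_connected t)) (u0 t) (uA t) wA.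
  have c0 : c != 0.
    by apply/eqP => c0; have := w0 x0; rewrite cE c0 mul0r ltxx.
  have ux' : u t x' != 0 by rewrite gt_eqF.
  have lt : lam t != 0 by rewrite gt_eqF// pf_eigenvalue_tilt_gt0.
  by rewrite !cE; field; rewrite c0 lt ux'.
exists u; split => //.
  move=> n x.
  by apply: (Cn_eigenvector x0 tilt_ge0 tilt_strongly_connected
    u0 r0 uA Ar u1) => // *; exact: Cn_tilt.
move=> t x'; split => [x|].
  rewrite famE; have lt := pf_eigenvalue_tilt_gt0 t.
  by apply: mulr_ge0; [apply: mulr_ge0; [apply: mulr_ge0|exact: tilt_ge0]|];
     rewrite ?invr_ge0 ltW.
have ux' : u t x' != 0 by rewrite gt_eqF.
have lt : lam t != 0 by rewrite gt_eqF// pf_eigenvalue_tilt_gt0.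
(* The left eigenvector equation says exactly that column x' of the family sums to 1. *)
have := uA t x'; rewrite /mulfv => uAx'.
rewrite (eq_bigr (fun x => tilt W g t x x' * u t x * ((lam t)^-1 * (u t x')^-1))).
  by rewrite -mulr_suml uAx' mulrACA !mulfV// mulr1.
by move=> x _; rewrite famE; ring.
Qed.

End Tilt.

(** * Scores of path laws *)

Section PathLaw.
Context {R : realType} {X : finType}.

(** Index 0 is the earliest state, so this adds a new initial state and shifts the rest of the
    path. *)
Definition path_cons n (p : X * {ffun 'I_n.+1 -> X}) : {ffun 'I_n.+2 -> X} :=
  [ffun i => if unlift ord0 i is Some j then p.2 j else p.1].

Lemma path_cons_bij n : bijective (@path_cons n).
Proof.
pose uncons (w : {ffun 'I_n.+2 -> X}) : X * {ffun 'I_n.+1 -> X} :=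
  (w ord0, [ffun j => w (lift ord0 j)]).
exists uncons => [[a v]|w].
  rewrite /uncons /path_cons ffunE unlift_none; congr (_, _).
  by apply/ffunP => j; rewrite !ffunE liftK.
apply/ffunP => i; rewrite ffunE.
by case: unliftP => [j ->|->]; rewrite ?ffunE.
Qed.

(** Fixing the initial state leaves a path law with an initial weight that need not have total 1;
    therefore [p] is an arbitrary function here and in [path_law_total]. *)
Lemma path_law_cons n (V : X -> X -> R) p (a : X) (v : {ffun 'I_n.+1 -> X}) :
  path_law V p (path_cons (a, v)) = path_law V (fun y => V y a * p a) v.
Proof.
rewrite /path_law big_ord_recl.
have lE (i : 'I_n.+1) : path_cons (a, v) (lift ord0 i) = v i.
  by rewrite ffunE liftK.
have oE : path_cons (a, v) ord0 = a by rewrite ffunE unlift_none.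
have wE (i : 'I_n) : widen_ord (leqnSn n.+1) (lift ord0 i) =
   lift ord0 (widen_ord (leqnSn n) i) by apply: val_inj.
have w0 : widen_ord (leqnSn n.+1) ord0 = ord0 by apply: val_inj.
rewrite /path_tgt /path_src lE w0 oE mulrAC [RHS]mulrC.
by congr (_ * _); apply: eq_bigr => i _; rewrite wE !lE.
Qed.

Lemma path_law_total n (V : X -> X -> R) p : is_transition V ->
  \sum_(w : {ffun 'I_n.+1 -> X}) path_law V p w = \sum_x p x.
Proof.
move=> Vt; elim: n p => [|n IH] p.
  rewrite (reindex (fun x : X => [ffun=> x] : {ffun 'I_1 -> X})) /=.
    by apply: eq_bigr => x _; rewrite /path_law big_ord0 mul1r ffunE.
  exists (fun w : {ffun 'I_1 -> X} => w ord0) => [x _|w _]; first by rewrite ffunE.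
  by apply/ffunP => i; rewrite ffunE (ord1 i).
rewrite (reindex (@path_cons n)); last exact: onW_bij (@path_cons_bij n).
rewrite (eq_bigr (fun q => path_law V (fun y => V y q.1 * p q.1) q.2)); last first.
  by move=> [a v] _; exact: path_law_cons.
rewrite -(pair_bigA _ (fun a v => path_law V (fun y => V y a * p a) v))/=.
apply: eq_bigr => a _; rewrite IH -mulr_suml.
by have [_ ->] := Vt a; rewrite mul1r.
Qed.

Lemma path_law_ge0 n (V : X -> X -> R) p (w : {ffun 'I_n.+1 -> X}) :
  is_transition V -> is_distribution p -> 0 <= path_law V p w.
Proof.
move=> Vt [p0 _]; rewrite mulr_ge0 ?prodr_ge0// => i _.
by have [] := Vt (path_src w i).
Qed.

Lemma path_telescope n (h : X -> R) (w : {ffun 'I_n.+1 -> X}) :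
  \sum_(i < n) (h (path_tgt w i) - h (path_src w i)) = h (w ord_max) - h (w ord0).
Proof.
rewrite sumrB.
have := @big_ord_recl R 0 +%R n (fun i => h (w i)).
rewrite big_ord_recr/= => e.
have -> : \sum_(i < n) h (path_tgt w i) =
    \sum_(i < n) h (path_src w i) + h (w ord_max) - h (w ord0).
  by rewrite e addrC addKr.
by ring.
Qed.

(** The ratios u(x)/u(x') telescope along the path, and the n factors of the inverse eigenvalue give
    the term with the potential. *)
Lemma path_law_exp_family n d (W : X -> X -> R) (g : 'I_d -> X -> X -> R) t
    (u : X -> R) p (w : {ffun 'I_n.+1 -> X}) :
  0 < pf_eigenvalue (tilt W g t) -> (forall x, 0 < u x) ->
  (forall x x', exp_family W g t x x' =
    (pf_eigenvalue (tilt W g t))^-1 * u x * tilt W g t x x' * (u x')^-1) ->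
  path_law (exp_family W g t) p w = path_law W p w *
    expR (\sum_j t 0 j * sample_sum g w j - n%:R * potential W g t +
          (ln (u (w ord_max)) - ln (u (w ord0)))).
Proof.
move=> l0 u0 famE; rewrite /path_law mulrAC; congr (_ * _).
have stepE i : exp_family W g t (path_tgt w i) (path_src w i) =
    W (path_tgt w i) (path_src w i) *
    expR (\sum_j t 0 j * g j (path_tgt w i) (path_src w i) - potential W g t
      + (ln (u (path_tgt w i)) - ln (u (path_src w i)))).
  rewrite famE /tilt /potential !expRD !expRN !lnK ?posrE//; ring.
rewrite (eq_bigr _ (fun i _ => stepE i)) big_split/=; congr (_ * _).
rewrite -expR_sum big_split/= (path_telescope (fun x => ln (u x))) big_split/=.
have -> : \sum_(i < n) \sum_j t 0 j * g j (path_tgt w i) (path_src w i) =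
    \sum_j t 0 j * sample_sum g w j.
  by rewrite exchange_big; apply: eq_bigr => j _; rewrite -mulr_sumr.
by rewrite sumr_const card_ord mulNrn -[_ *+ n]mulr_natl.
Qed.

End PathLaw.

(** * Score identities for a normalized finite family of exponential weights *)

Section Score.
Context {R : realType} {d : nat} {T : finType}.
Implicit Types (t v : 'rV[R]_d).

Lemma is_derive_fsum t v (F : T -> 'rV[R]_d -> R) (dF : T -> R) :
  (forall w, is_derive t v (F w : 'rV[R]_d -> R^o) (dF w)) ->
  is_derive t v (fun s => \sum_w F w s : R^o) (\sum_w dF w).
Proof.
move=> FdF; elim: (index_enum T) => [|w s IH].
  by under eq_fun do rewrite big_nil; rewrite big_nil; exact: is_derive_cst.
by under eq_fun do rewrite big_cons; rewrite big_cons; exact: is_deriveD.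
Qed.

Variables (C : T -> R) (E : T -> 'rV[R]_d -> R).
Hypothesis CE : forall w, Cn 2 (E w).
Hypothesis total1 : forall t, \sum_w C w * expR (E w t) = 1.

Let is_derive_cst_eq0 (F : 'rV[R]_d -> R) (c : R) t v df : (forall s, F s = c) ->
  is_derive t v (F : 'rV[R]_d -> R^o) df -> df = 0.
Proof.
by move=> /funext -> [_ <-]; exact: derive_cst.
Qed.

Let is_derive_weight w j t : is_derive t (basis_vec j)
  (fun t => C w * expR (E w t) : R^o) (C w * expR (E w t) * partial j (E w) t).
Proof.
have h : is_derive t (basis_vec j) (fun t => expR (E w t) : R^o)
    (expR (E w t) * partial j (E w) t).
  by apply: is_derive_comp; exact: CnS_is_derive (CE w).
by rewrite -mulrA; apply: (is_deriveZ (C w) h).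
Qed.

(** The first derivative of [total1]. *)
Lemma score_mean j t :
  \sum_w C w * expR (E w t) * partial j (E w) t = 0.
Proof.
apply: (is_derive_cst_eq0 total1 (t := t) (v := basis_vec j)).
by apply: is_derive_fsum => w; exact: is_derive_weight.
Qed.

(** The derivative of [score_mean]: the two forms of the Fisher information agree. *)
Lemma score_second_moment i j t :
  \sum_w C w * expR (E w t) * (partial i (E w) t * partial j (E w) t) =
  - \sum_w C w * expR (E w t) * partial i (partial j (E w)) t.
Proof.
apply/eqP; rewrite -addr_eq0 -big_split/=; apply/eqP.
apply: (is_derive_cst_eq0 (score_mean j) (t := t) (v := basis_vec i)).
apply: is_derive_fsum => w.
have h := CnS_is_derive i t (CnS_partial j (CE w)).
apply: is_derive_eq (is_deriveM (is_derive_weight w i t) h) _.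
by rewrite /GRing.scale/=; ring.
Qed.

End Score.

(** * Moment estimates *)

Section MomentEstimates.
Context {R : realType} {T : finType}.
Variable L : T -> R.
Hypothesis L0 : forall w, 0 <= L w.
Hypothesis L1 : \sum_w L w = 1.
Implicit Types (F G M b k : T -> R).

(** When [L] is a path law this unfolds to [expect], so the estimates below apply to path
    expectations directly. *)
Definition mean F : R := \sum_w L w * F w.

Lemma meanD F G : mean (fun w => F w + G w) = mean F + mean G.
Proof. by rewrite /mean -big_split; apply: eq_bigr => w _; rewrite mulrDr. Qed.

Lemma meanZ c F : mean (fun w => c * F w) = c * mean F.
Proof. by rewrite /mean mulr_sumr; apply: eq_bigr => w _; rewrite mulrCA. Qed.

Lemma mean_cst c : mean (fun=> c) = c.
Proof. by rewrite /mean -mulr_suml L1 mul1r. Qed.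

Lemma ler_mean F G : (forall w, F w <= G w) -> mean F <= mean G.
Proof. by move=> FG; apply: ler_sum => w _; rewrite ler_wpM2l. Qed.

Lemma norm_mean F : `|mean F| <= mean (fun w => `|F w|).
Proof.
apply: le_trans (ler_norm_sum _ _ _) _; apply: ler_sum => w _.
by rewrite normrM (ger0_norm (L0 w)).
Qed.

Lemma norm_mean_le F B : (forall w, `|F w| <= B) -> `|mean F| <= B.
Proof.
by move=> FB; rewrite (le_trans (norm_mean F))// -[leRHS]mean_cst ler_mean.
Qed.

(** Completing the square gives |M| <= M^2 / a + a pointwise, which replaces Cauchy-Schwarz. With
    a^2 = n, a second moment of order n yields a first absolute moment of order sqrt n. *)
Lemma mean_norm_le M a Q : 0 < a -> mean (fun w => M w * M w) <= Q * a ^+ 2 ->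
  mean (fun w => `|M w|) <= a * (Q + 1).
Proof.
move=> a0 MQ.
have step w : `|M w| <= a^-1 * (M w * M w) + a.
  rewrite -(ler_pM2l a0) mulrDr mulrA mulfV ?gt_eqF// mul1r.
  rewrite -[M w * M w]ger0_norm -?expr2 ?sqr_ge0// normrX.
  have := sqr_ge0 (`|M w| - a / 2); have := sqr_ge0 a.
  rewrite !expr2; nra.
apply: le_trans (ler_mean step) _; rewrite meanD meanZ mean_cst mulrDr mulr1 lerD2r.
by rewrite ler_pdivrMl// (le_trans MQ)// expr2 mulrC mulrA.
Qed.

(** Here [F] and [F'] stand for two sample sums, [a] for sqrt n, [b] and [b'] for the boundary terms
    of the scores [M] and [M'], the [k] for the boundary terms of second derivatives, and the [h]
    for Hessian entries. *)
Variables (n : nat) (a B : R) (F F' : T -> R) (eta eta' h11 h22 h12 : R).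
Variables (b b' k11 k22 k12 : T -> R).
Hypothesis n_gt0 : (0 < n)%N.
Hypothesis a_ge1 : 1 <= a.
Hypothesis a2 : a ^+ 2 = n%:R.
Hypothesis bB : forall w, `|b w| <= B.
Hypothesis b'B : forall w, `|b' w| <= B.
Hypothesis k11B : forall w, `|k11 w| <= B.
Hypothesis k22B : forall w, `|k22 w| <= B.
Hypothesis k12B : forall w, `|k12 w| <= B.
Let M w := F w - n%:R * eta + b w.
Let M' w := F' w - n%:R * eta' + b' w.
Hypothesis M0 : mean M = 0.
Hypothesis M'0 : mean M' = 0.
Hypothesis M11 : mean (fun w => M w * M w) = n%:R * h11 - mean k11.
Hypothesis M22 : mean (fun w => M' w * M' w) = n%:R * h22 - mean k22.
Hypothesis M12 : mean (fun w => M w * M' w) = n%:R * h12 - mean k12.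

Let n0 : n%:R != 0 :> R.
Proof. by rewrite pnatr_eq0 -lt0n. Qed.

(** Expanding (M - b)(M' - b') leaves, over n, the bounded terms E[b b'] and E[k12] and the mixed
    terms E[M b'] and E[M' b] of order sqrt n. *)
Lemma mse_estimate :
  `|n%:R * mean (fun w => (F w / n%:R - eta) * (F' w / n%:R - eta')) - h12| <=
  (B + B * (`|h11| + B + 1) + B * (`|h22| + B + 1) + B * B) / a.
Proof.
have a0 : 0 < a by exact: lt_le_trans a_ge1.
have B0 : 0 <= B.
  by have := norm_mean_le bB; apply: le_trans.
(* Since a^2 = n >= 1, the second moment n h - E[k] is at most (|h| + B) a^2. *)
have Mabs (N k : T -> R) h : (forall w, `|k w| <= B) ->
    mean (fun w => N w * N w) = n%:R * h - mean k ->
    mean (fun w => `|N w|) <= a * (`|h| + B + 1).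
  move=> kB Nh; apply: mean_norm_le => //; rewrite Nh a2 mulrDl [leRHS]addrC.
  have := norm_mean_le kB; rewrite ler_norml => /andP[h1 h2].
  have h3 : n%:R * h <= `|h| * n%:R by rewrite mulrC ler_wpM2r// ler_norm.
  have h4 : B <= B * n%:R by rewrite ler_peMr// ler1n.
  lra.
have mixed (N c : T -> R) : (forall w, `|c w| <= B) ->
    `|mean (fun w => N w * c w)| <= B * mean (fun w => `|N w|).
  move=> cB; apply: le_trans (norm_mean _) _; rewrite -meanZ; apply: ler_mean => w.
  by rewrite normrM mulrC ler_wpM2r.
have E1 : n%:R * mean (fun w => (F w / n%:R - eta) * (F' w / n%:R - eta')) - h12 =
   (mean (fun w => b w * b' w) - mean (fun w => M w * b' w)
    - mean (fun w => M' w * b w) - mean k12) / n%:R.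
  apply: (mulIf n0); rewrite divfK// mulrBl mulrAC -expr2 -meanZ.
  have -> : mean (fun w => n%:R ^+ 2 *
      ((F w / n%:R - eta) * (F' w / n%:R - eta'))) =
     mean (fun w => M w * M' w +
       (b w * b' w + -1 * (M w * b' w) + -1 * (M' w * b w))).
    by congr mean; apply/funext => w; rewrite /M /M'; field.
  by rewrite !meanD !meanZ M12; ring.
have bb : `|mean (fun w => b w * b' w)| <= B * B.
  by apply: norm_mean_le => w; rewrite normrM ler_pM.
have h1 := le_trans (mixed M b' b'B) (ler_wpM2l B0 (Mabs M k11 h11 k11B M11)).
have h2 := le_trans (mixed M' b bB) (ler_wpM2l B0 (Mabs M' k22 h22 k22B M22)).
have h3 := norm_mean_le k12B.
rewrite E1 normrM normfV [`|n%:R|]ger0_norm ?ler0n// -a2 expr2 invfM mulrA.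
rewrite ler_pM2r ?invr_gt0// ler_pdivrMr//.
have aB : B <= B * a by rewrite ler_peMr.
have aBB : B * B <= B * B * a by rewrite ler_peMr// mulr_ge0.
move: bb h1 h2 h3.
set X1 := mean _; set X2 := mean _; set X3 := mean _; set X4 := mean _.
set Q1 := `|h11| + B + 1; set Q2 := `|h22| + B + 1.
rewrite !ler_norml => /andP[? ?] /andP[? ?] /andP[? ?] /andP[? ?].
by apply/andP; split; lra.
Qed.

(** Covariance is mean square error minus the product of the biases. As the scores have mean 0, the
    bias of F/n is -E[b]/n, which accounts for the additional B^2 in the constant. *)
Lemma cov_estimate :
  `|n%:R * mean (fun w => (F w / n%:R - mean (fun w => F w / n%:R)) *
                          (F' w / n%:R - mean (fun w => F' w / n%:R))) - h12| <=
  (B + B * (`|h11| + B + 1) + B * (`|h22| + B + 1) + 2 * (B * B)) / a.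
Proof.
have a0 : 0 < a by exact: lt_le_trans a_ge1.
have bias (G c : T -> R) e : mean (fun w => G w - n%:R * e + c w) = 0 ->
    mean (fun w => G w / n%:R) - e = - mean c / n%:R.
  rewrite !meanD mean_cst => h; apply: (mulIf n0); rewrite mulrBl divfK//.
  under [in mean _]eq_fun do rewrite mulrC.
  by rewrite meanZ mulrAC mulVf// mul1r; lra.
have e1 := bias _ _ _ M0; have e2 := bias _ _ _ M'0.
have -> : n%:R * mean (fun w => (F w / n%:R - mean (fun w => F w / n%:R)) *
                          (F' w / n%:R - mean (fun w => F' w / n%:R))) - h12 =
    (n%:R * mean (fun w => (F w / n%:R - eta) * (F' w / n%:R - eta')) - h12) -
    mean b * mean b' / n%:R.
  move: e1 e2; set m := mean (fun w => F w / n%:R).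
  set m' := mean (fun w => F' w / n%:R).
  move=> e1 e2.
  have -> : mean (fun w => (F w / n%:R - m) * (F' w / n%:R - m')) =
     mean (fun w => (F w / n%:R - eta) * (F' w / n%:R - eta') +
      ((- (m' - eta')) * (F w / n%:R) +
       ((- (m - eta)) * (F' w / n%:R) + (m * m' - eta * eta')))).
    by congr mean; apply/funext => w; ring.
  rewrite !meanD !meanZ !mean_cst -/m -/m'.
  rewrite (_ : - (m' - eta') * m + (- (m - eta) * m' + (m * m' - eta * eta')) =
     - ((m - eta) * (m' - eta'))); last by ring.
  by rewrite e1 e2; field.
apply: le_trans (ler_normB _ _) _.
rewrite (_ : 2 * (B * B) = B * B + B * B); last by ring.
rewrite addrA mulrDl lerD ?mse_estimate// normrM normfV [`|n%:R|]ger0_norm ?ler0n//.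
rewrite -a2 expr2 invfM mulrA ler_pM2r ?invr_gt0// ler_pdivrMr//.
rewrite normrM; apply: (@le_trans _ _ (B * B)).
  by rewrite ler_pM// norm_mean_le.
rewrite ler_peMr// mulr_ge0//.
  by apply: le_trans (norm_mean_le bB).
by apply: le_trans (norm_mean_le bB).
Qed.

End MomentEstimates.

Lemma cvg_of_sqrt_bound (R : realType) (s : nat -> R) (l K : R) :
  (forall n, (0 < n)%N -> `|s n - l| <= K / Num.sqrt n%:R) -> s @ \oo --> l.
Proof.
move=> sK.
have K0 : (fun n => K * Num.sqrt (harmonic n)) @ \oo --> (0 : R).
  rewrite -[X in _ --> X](mulr0 K); apply: cvgM; first exact: cvg_cst.
  rewrite -[X in _ --> X]sqrtr0.
  exact: (cvg_comp _ _ (@cvg_harmonic R) (@sqrt_continuous R 0)).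
(* [harmonic n] is 1/(n+1), so the shift matches the indices and discards n = 0, where no bound is
   assumed. *)
rewrite -cvg_shiftS; apply/cvgrPdist_le => e e0.
move/cvgrPdist_le : K0 => /(_ e e0); apply: filterS => n.
rewrite sub0r normrN => h; rewrite distrC.
apply: le_trans (sK n.+1 _) _ => //; apply: le_trans h.
by rewrite /harmonic sqrtrV ?ler0n// ler_norm.
Qed.

Lemma cvg_mx_entries (R : realType) d (M : nat -> 'M[R]_d) (L : 'M[R]_d) :
  (forall i j, (fun n => M n i j) @ \oo --> L i j) -> M @ \oo --> L.
Proof.
move=> ML; apply/cvg_ballP => e e0.
have h : \forall n \near \oo, forall i j, ball (L i j) e (M n i j).
  apply: filter_forall => i; apply: filter_forall => j.
  by move/cvg_ballP : (ML i j); apply.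
by apply: filterS h => n h; split.
Qed.

(** * Convergence *)

(** Bounds the boundary terms h(X_{n+1}) - h(X_1) uniformly in the path and in n. *)
Lemma norm_sub_le_sum (R : realType) (X : finType) (h : X -> R) x y :
  `|h x - h y| <= 2 * \sum_z `|h z|.
Proof.
have hS z : `|h z| <= \sum_z `|h z| by rewrite (bigD1 z)//= lerDl sumr_ge0.
by rewrite mulr_natl mulr2n (le_trans (ler_normB _ _))// lerD.
Qed.

(** * The score of the path law of the exponential family *)

Section PathScore.
Context {R : realType} {X : finType} {d : nat}.
Variables (W : X -> X -> R) (g : 'I_d -> X -> X -> R) (p : X -> R).
Variable u : 'rV[R]_d -> X -> R.
Hypothesis p_distribution : is_distribution p.
Hypothesis u0 : forall t x, 0 < u t x.
Hypothesis lam0 : forall t, 0 < pf_eigenvalue (tilt W g t).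
Hypothesis famE : forall t x x', exp_family W g t x x' =
  (pf_eigenvalue (tilt W g t))^-1 * u t x * tilt W g t x x' * (u t x')^-1.
Hypothesis Cu : forall n x, Cn n (fun t => u t x).
Hypothesis Clam : forall n, Cn n (fun t => pf_eigenvalue (tilt W g t)).
Hypothesis fam_transition : forall t, is_transition (exp_family W g t).
Variable n : nat.
Implicit Types (t : 'rV[R]_d) (w : {ffun 'I_n.+1 -> X}).

(** The logarithmic density with respect to the path law of [W] with the same initial distribution
    [p], which is held fixed while [t] varies. *)
Definition log_density w t : R :=
  \sum_j t 0 j * sample_sum g w j - n%:R * potential W g t +
  (ln (u t (w ord_max)) - ln (u t (w ord0))).

Let psi (x : X) t := ln (u t x).
Let f j x t := partial j (psi x) t.

Lemma Cn_potential m : Cn m (potential W g).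
Proof. exact: Cn_ln. Qed.

Let Cpsi m x : Cn m (psi x).
Proof. by apply: Cn_ln. Qed.

Lemma Cn_log_density m w : Cn m (log_density w).
Proof.
apply: CnD; last by apply: CnD; [exact: Cpsi|apply: CnN; exact: Cpsi].
apply: CnD; last by apply: CnN; apply: CnM; [exact: Cn_cst|exact: Cn_potential].
by apply: Cn_sum => j; apply: CnM; [exact: Cn_coord|exact: Cn_cst].
Qed.

Lemma partial_log_density w j t : partial j (log_density w) t =
  sample_sum g w j - n%:R * partial j (potential W g) t +
  (f j (w ord_max) t - f j (w ord0) t).
Proof.
have h : is_derive t (basis_vec j) (fun s => \sum_k s 0 k * sample_sum g w k : R^o)
    (sample_sum g w j).
  have -> : sample_sum g w j = \sum_k sample_sum g w k * (k == j)%:R.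
    rewrite (bigD1 j)//= eqxx mulr1 big1 ?addr0// => k /negbTE ->.
    by rewrite mulr0.
  have -> : (fun s : 'rV[R]_d => \sum_k s 0 k * sample_sum g w k) =
      fun s => \sum_k sample_sum g w k * s 0 k.
    by apply/funext => s; apply: eq_bigr => k _; rewrite mulrC.
  apply: is_derive_fsum => k.
  exact: (is_deriveZ _ (is_derive_coord k j t)).
have hphi := CnS_is_derive j t (Cn_potential 1).
have := is_deriveD (is_deriveB h (is_deriveZ n%:R hphi))
  (is_deriveB (CnS_is_derive j t (Cpsi 1 (w ord_max)))
              (CnS_is_derive j t (Cpsi 1 (w ord0)))).
by case.
Qed.

Lemma partial2_log_density w i j t : partial i (partial j (log_density w)) t =
  - (n%:R * partial i (partial j (potential W g)) t) +
  (partial i (f j (w ord_max)) t - partial i (f j (w ord0)) t).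
Proof.
rewrite (_ : partial j (log_density w) = fun t =>
    sample_sum g w j - n%:R * partial j (potential W g) t +
    (f j (w ord_max) t - f j (w ord0) t)); last first.
  by apply/funext => s; exact: partial_log_density.
have hphi := CnS_is_derive i t (CnS_partial j (Cn_potential 2)).
have hf x := CnS_is_derive i t (CnS_partial j (Cpsi 2 x)).
have := is_deriveD (is_deriveB
    (is_derive_cst (sample_sum g w j : R^o) t (basis_vec i))
  (is_deriveZ n%:R hphi)) (is_deriveB (hf (w ord_max)) (hf (w ord0))).
by case => _; rewrite sub0r.
Qed.

Lemma path_law_log_density w t : path_law (exp_family W g t) p w =
  path_law W p w * expR (log_density w t).
Proof. exact: path_law_exp_family. Qed.

Lemma path_law_density_total t :
  \sum_w path_law W p w * expR (log_density w t) = 1.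
Proof.
under eq_bigr do rewrite -path_law_log_density.
by rewrite path_law_total//; have [] := p_distribution.
Qed.

Lemma mean_path_score j t : mean (path_law (exp_family W g t) p) (fun w =>
  sample_sum g w j - n%:R * partial j (potential W g) t +
  (f j (w ord_max) t - f j (w ord0) t)) = 0.
Proof.
rewrite -(score_mean (fun w => Cn_log_density 2 w) path_law_density_total j t).
by apply: eq_bigr => w _; rewrite partial_log_density path_law_log_density.
Qed.

Lemma mean_path_score2 i j t : mean (path_law (exp_family W g t) p) (fun w =>
  (sample_sum g w i - n%:R * partial i (potential W g) t +
    (f i (w ord_max) t - f i (w ord0) t)) *
  (sample_sum g w j - n%:R * partial j (potential W g) t +
    (f j (w ord_max) t - f j (w ord0) t))) =
  n%:R * hessian (potential W g) t i j -
  mean (path_law (exp_family W g t) p)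
    (fun w => partial i (f j (w ord_max)) t - partial i (f j (w ord0)) t).
Proof.
have := score_second_moment (fun w => Cn_log_density 2 w)
  path_law_density_total i j t.
rewrite /mean => e; transitivity (\sum_w path_law W p w * expR (log_density w t) *
    (partial i (log_density w) t * partial j (log_density w) t)).
  by apply: eq_bigr => w _; rewrite !partial_log_density path_law_log_density.
(* The constant n H_ij is multiplied by the total mass 1 to bring it under the sum over paths. *)
rewrite {}e mxE -[n%:R * _]mul1r -[X in X * _ - _](path_law_density_total t).
rewrite mulr_suml -sumrB -sumrN.
apply: eq_bigr => w _; rewrite partial2_log_density path_law_log_density.
move: (_ * expR _) (n%:R * _) (_ - _) => a b c.
by rewrite mulrDr opprD mulrN opprK.
Qed.

End PathScore.

Theorem theorem8p2 (R : realType) (X : finType) (d : nat)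
    (W : X -> X -> R) (g : 'I_d -> X -> X -> R) (P : 'rV[R]_d -> X -> R)
    (W_transition : is_transition W)
    (W_irreducible : irreducible W)
    (W_ergodic : ergodic W)
    (g_indep : lin_indep_under W g)
    (P_distribution : forall t, is_distribution (P t))
    (P_smooth : forall x, smooth (fun t => P t x))
    (theta : 'rV[R]_d) :
  [/\ (forall t j, has_partial j (potential W g) t),
      (forall i j, has_partial i (partial j (potential W g)) theta),
      (fun n => n%:R *: mse_sample_mean W g P n theta) @ \oo
        --> hessian (potential W g) theta
    & (fun n => n%:R *: cov_sample_mean W g P n theta) @ \oo
        --> hessian (potential W g) theta].
Proof.
(* An empty [X] carries no distribution, since its total would be 0. *)
have [x0 _|noX] := pickP (@predT X); last first.
  have [_] := P_distribution theta.
  by rewrite big_pred0// => /esym/eqP; rewrite oner_eq0.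
have [u [u0 famE Cu Clam famT]] :=
  regular_perron_eigenvector x0 g W_transition W_irreducible.
have lam0 := pf_eigenvalue_tilt_gt0 x0 g W_transition W_irreducible.
have Cphi m : Cn m (potential W g) by exact: Cn_potential lam0 Clam m.
pose f j x t := partial j (fun t => ln (u t x)) t.
pose N (h : X -> R) := 2 * \sum_z `|h z|.
have N0 h : 0 <= N h by rewrite mulr_ge0// sumr_ge0.
(* The estimates use one bound for all five boundary terms; the sum of the five individual bounds
   serves. *)
pose B i j := N (f i ^~ theta) + N (f j ^~ theta) +
  N (fun x => partial i (f i x) theta) + N (fun x => partial j (f j x) theta) +
  N (fun x => partial i (f j x) theta).
have NB h x y c : N h <= c -> `|h x - h y| <= c.
  exact: le_trans (norm_sub_le_sum h x y).
pose L n (w : {ffun 'I_n.+1 -> X}) := path_law (exp_family W g theta) (P theta) w.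
have L0 n w : 0 <= @L n w by exact: path_law_ge0.
have L1 n : \sum_w @L n w = 1.
  by rewrite /L path_law_total//; have [] := P_distribution theta.
(* The score identities are applied with the initial distribution frozen at [P theta] and evaluated
   at [theta]. *)
have M0 n j := @mean_path_score R X d W g (P theta) u (P_distribution theta)
  u0 lam0 famE Cu Clam famT n j theta.
have M2 n i j := @mean_path_score2 R X d W g (P theta) u (P_distribution theta)
  u0 lam0 famE Cu Clam famT n i j theta.
have a1 n : (0 < n)%N -> 1 <= Num.sqrt (n%:R : R).
  by move=> n0; rewrite -[leLHS]sqrtr1 ler_wsqrtr// ler1n.
have a2 n : Num.sqrt (n%:R : R) ^+ 2 = n%:R by rewrite sqr_sqrtr.
pose H := hessian (potential W g) theta.
pose b n j (w : {ffun 'I_n.+1 -> X}) := f j (w ord_max) theta - f j (w ord0) theta.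
pose k n i j (w : {ffun 'I_n.+1 -> X}) :=
  partial i (f j (w ord_max)) theta - partial i (f j (w ord0)) theta.
have le_sum5 (c1 c2 c3 c4 c5 : R) : 0 <= c1 -> 0 <= c2 -> 0 <= c3 -> 0 <= c4 ->
    0 <= c5 -> let c := c1 + c2 + c3 + c4 + c5 in
    [/\ c1 <= c, c2 <= c, c3 <= c, c4 <= c & c5 <= c].
  by move=> h1 h2 h3 h4 h5 /=; split; lra.
have BE i j : [/\ N (f i ^~ theta) <= B i j, N (f j ^~ theta) <= B i j,
    N (fun x => partial i (f i x) theta) <= B i j,
    N (fun x => partial j (f j x) theta) <= B i j &
    N (fun x => partial i (f j x) theta) <= B i j].
  exact: le_sum5 (N0 _) (N0 _) (N0 _) (N0 _) (N0 _).
split.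
- by move=> t j; have [_ /(_ j)[]] := Cphi 1%N.
- by move=> i j; have [_ /(_ i)[]] := CnS_partial j (Cphi 2%N).
- apply: cvg_mx_entries => i j; apply: (@cvg_of_sqrt_bound _ _ _
    (B i j + B i j * (`|H i i| + B i j + 1) +
    B i j * (`|H j j| + B i j + 1) + B i j * B i j)) => n n0.
  have [B1 B2 B3 B4 B5] := BE i j.
  rewrite mxE [X in _ * X - _]mxE.
  exact: (@mse_estimate R _ (@L n) (L0 n) (L1 n) n (Num.sqrt n%:R) (B i j)
    (fun w => sample_sum g w i) (fun w => sample_sum g w j)
    (partial i (potential W g) theta) (partial j (potential W g) theta)
    (H i i) (H j j) (H i j)
    (@b n i) (@b n j) (@k n i i) (@k n j j) (@k n i j)
    n0 (a1 n n0) (a2 n) (fun w => NB (f i ^~ theta) _ _ _ B1)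
    (fun w => NB (f j ^~ theta) _ _ _ B2)
    (fun w => NB (fun x => partial i (f i x) theta) _ _ _ B3)
    (fun w => NB (fun x => partial j (f j x) theta) _ _ _ B4)
    (fun w => NB (fun x => partial i (f j x) theta) _ _ _ B5)
    (M2 n i i) (M2 n j j) (M2 n i j)).
- apply: cvg_mx_entries => i j; apply: (@cvg_of_sqrt_bound _ _ _
    (B i j + B i j * (`|H i i| + B i j + 1) +
    B i j * (`|H j j| + B i j + 1) + 2 * (B i j * B i j))) => n n0.
  have [B1 B2 B3 B4 B5] := BE i j.
  rewrite mxE [X in _ * X - _]mxE.
  exact: (@cov_estimate R _ (@L n) (L0 n) (L1 n) n (Num.sqrt n%:R) (B i j)
    (fun w => sample_sum g w i) (fun w => sample_sum g w j)
    (partial i (potential W g) theta) (partial j (potential W g) theta)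
    (H i i) (H j j) (H i j)
    (@b n i) (@b n j) (@k n i i) (@k n j j) (@k n i j)
    n0 (a1 n n0) (a2 n) (fun w => NB (f i ^~ theta) _ _ _ B1)
    (fun w => NB (f j ^~ theta) _ _ _ B2)
    (fun w => NB (fun x => partial i (f i x) theta) _ _ _ B3)
    (fun w => NB (fun x => partial j (f j x) theta) _ _ _ B4)
    (fun w => NB (fun x => partial i (f j x) theta) _ _ _ B5)
    (M0 n i) (M0 n j) (M2 n i i) (M2 n j j) (M2 n i j)).
Qed.
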